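(* Let $d\ge 2$ and let $\mu$ be an $x_d$ slice singular Borel probability measure on $[0,1)^d$. For $f\in L^2(\mu)$ let $c_{n_1,\dots,n_d}=c_{n_1,\dots,n_d}(f)$ be the Fourier coefficients of $f$ produced by the iterated operator Kaczmarz algorithm (defined in the context). Then $$c_{n_1,\dots,n_d}=\big\langle f(x_1,\dots,x_d),\; g_{n_d}^{x_1,\dots,x_{d-1}}(x_d)\,g_{n_{d-1}}^{x_1,\dots,x_{d-2}}(x_{d-1})\cdots g_{n_2}^{x_1}(x_2)\,g_{n_1}(x_1)\big\rangle_{L^2(\mu)}$$ for all $n_1,\dots,n_d\in\mathbb{N}$. Furthermore, the family $\{g_{n_d}^{x_1,\dots,x_{d-1}}\cdots g_{n_2}^{x_1}g_{n_1}\}_{(n_1,\dots,n_d)\in\mathbb{N}^d}$ is a Parseval frame in $L^2(\mu)$, i.e. $\|f\|^2=\sum_{n_1,\dots,n_d}|\langle f,g_{n_d}^{x_1,\dots,x_{d-1}}\cdots g_{n_1}\rangle_{L^2(\mu)}|^2$ for every $f\in L^2(\mu)$.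
   Context: $\mathbb{N}=\{0,1,2,\dots\}$. ''Singular'', for a Borel measure on $[0,1)$, means singular with respect to Lebesgue measure. Inner products are linear in the first slot. Disintegration: for a Borel probability measure $\nu$ on $[0,1)^{k}=[0,1)^{k-1}\times[0,1)$, $k\ge2$, its marginal measure is the push-forward of $\nu$ under $(x_1,\dots,x_k)\mapsto(x_1,\dots,x_{k-1})$, and its slice measures $\{\gamma^{x_1,\dots,x_{k-1}}\}$ are the a.e. unique family of Borel probability measures on $[0,1)$ from the Rokhlin disintegration theorem, so that integration against $\nu$ is integration in $x_k$ against $\gamma^{x_1,\dots,x_{k-1}}$ followed by integration against the marginal. Set $\mu_0=\mu$ and, for $1\le n\le d-1$, let $\mu_n$ be the marginal measure of $\mu_{n-1}$ (a measure on $[0,1)^{d-n}$). For $2\le k\le d$, $\{\gamma^{x_1,\dots,x_{k-1}}\}$ are the slice measures (in the variable $x_k$) of $\mu_{d-k}$. Slice singular: if $d=2$, $\mu$ is $x_2$ slice singular if $\gamma^{x_1}$ is singular for $\mu_1$-a.e. $x_1$ and $\mu_1$ is singular; for $d\ge3$, inductively, $\mu$ is $x_d$ slice singular if $\gamma^{x_1,\dots,x_{d-1}}$ is singular for $\mu_1$-a.e. $(x_1,\dots,x_{d-1})$ and $\mu_1$ is $x_{d-1}$ slice singular. Auxiliary sequence of a Borel probability measure $\nu$ on $[0,1)$: with $e_n(x)=e^{2\pi i nx}$, $g_0=e_0$ and $g_n=e_n-\sum_{k=0}^{n-1}\langle e_n,e_k\rangle_{L^2(\nu)}\,g_k$ for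 $n\ge1$. For $2\le k\le d$, $\{g_{n}^{x_1,\dots,x_{k-1}}\}_{n\ge0}$ is the auxiliary sequence of $\gamma^{x_1,\dots,x_{k-1}}$ (a sequence of functions of $x_k$), and $\{g_{n}\}_{n\ge0}$ is the auxiliary sequence of $\mu_{d-1}$ (functions of $x_1$). Operators: for $2\le k\le d$ and $n\ge0$ let $R(n,k):L^2(\mu_{d-k})\to L^2(\mu_{d-k+1})$, $R(n,k)h=\int_0^1 h(x_1,\dots,x_k)e^{-2\pi i n x_k}\,d\gamma^{x_1,\dots,x_{k-1}}(x_k)$, and define $G(0,k)=R(0,k)$, $G(n,k)=R(n,k)-\sum_{j=0}^{n-1}R(n,k)R(j,k)^*G(j,k)$ for $n\ge1$. Fourier coefficients: for $f\in L^2(\mu)$, $c_{n_1,\dots,n_d}(f)=\langle G(n_2,2)G(n_3,3)\cdots G(n_d,d)f,\;g_{n_1}\rangle_{L^2(\mu_{d-1})}$. These are the coefficients in the expansion $f=\sum_{n_d=0}^\infty\cdots\sum_{n_1=0}^\infty c_{n_1,\dots,n_d}e^{2\pi i(n_1x_1+\cdots+n_dx_d)}$ (norm limits, sum over $n_1$ first). *)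

(* Defs.v *)
(* Elements of L^2 are represented by functions satisfying [L2]; equality in L^2
   is a.e. equality.  Borel measures on [0,1)^k are Borel measures on R^k
   concentrated on the cube. *)
From HB Require Import structures.
From mathcomp Require Import all_boot all_order all_algebra.
From mathcomp Require Import complex.
From mathcomp Require Import all_classical all_reals all_analysis.
From mathcomp Require Import measurable_realfun lebesgue_measure probability kernel.

Set Implicit Arguments.
Unset Strict Implicit.
Unset Printing Implicit Defensive.

Import Order.TTheory GRing.Theory Num.Theory.
Import numFieldNormedType.Exports.

Local Open Scope classical_set_scope.
Local Open Scope ring_scope.
Local Open Scope complex_scope.

Section ComplexL2.
Context {disp : measure_display} {T : measurableType disp} {R : realType}.
Implicit Types (mu : {measure set T -> \bar R}) (f g : T -> R[i]).

Definition cintegral mu f : R[i] :=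
  (\int[mu]_(x in setT) complex.Re (f x)) +i*
  (\int[mu]_(x in setT) complex.Im (f x)).

Definition cmeasurable f : Prop :=
  measurable_fun setT (fun x => complex.Re (f x)) /\
  measurable_fun setT (fun x => complex.Im (f x)).

Definition L2normsq mu f : \bar R :=
  (\int[mu]_(x in setT) ((Normc.normc (f x) ^+ 2)%:E))%E.

Definition L2 mu f : Prop := cmeasurable f /\ (L2normsq mu f < +oo)%E.

Definition inner mu f g : R[i] := cintegral mu (fun x => f x * (g x)^*).

Definition parseval_frame mu (I : choiceType) (phi : I -> T -> R[i]) : Prop :=
  (forall i, L2 mu (phi i)) /\
  forall f, L2 mu f ->
    L2normsq mu f =
    (\esum_(i in [set: I]) ((Normc.normc (inner mu f (phi i)) ^+ 2)%:E))%E.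

End ComplexL2.

(* [adjoint mu nu A h] is (a representative of) A^* h for a bounded operator
   A : L^2(mu) -> L^2(nu); it is determined mu-a.e. by the defining identity. *)
Definition adjoint {d1 d2 : measure_display} {T1 : measurableType d1}
    {T2 : measurableType d2} {R : realType}
    (mu : {measure set T1 -> \bar R}) (nu : {measure set T2 -> \bar R})
    (A : (T1 -> R[i]) -> (T2 -> R[i])) (h : T2 -> R[i]) : T1 -> R[i] :=
  xget 0 [set k | L2 mu k /\
                  forall f, L2 mu f -> inner nu (A f) h = inner mu f k].

(* The solution of a_n = b_n - \sum_(j < n) K n j a_j, see [triangular_recE]. *)
Section TriangularRecursion.
Context {V : zmodType}.
Variables (b : nat -> V) (K : nat -> nat -> V -> V).

Fixpoint triangular_seq (n : nat) : seq V :=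
  if n is m.+1 then
    let s := triangular_seq m in
    rcons s (b m - \sum_(j < m) K m j (nth 0 s j))
  else [::].

Definition triangular_rec (n : nat) : V := nth 0 (triangular_seq n.+1) n.

Lemma size_triangular_seq n : size (triangular_seq n) = n.
Proof. by elim: n => //= n IHn; rewrite size_rcons IHn. Qed.

Lemma nth_triangular_seq n j :
  (j < n)%N -> nth 0 (triangular_seq n) j = triangular_rec j.
Proof.
elim: n => // n IHn; rewrite ltnS leq_eqVlt => /predU1P[->//|ltjn].
by rewrite /= nth_rcons size_triangular_seq ltjn IHn.
Qed.

Lemma triangular_recE n :
  triangular_rec n = b n - \sum_(j < n) K n j (triangular_rec j).
Proof.
rewrite {1}/triangular_rec /= nth_rcons size_triangular_seq ltnn eqxx.
by congr (_ - _); apply: eq_bigr => j _; rewrite nth_triangular_seq.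
Qed.

End TriangularRecursion.

Section OneVariable.
Context {R : realType}.
Implicit Types nu : {measure set R -> \bar R}.

Definition Ico01 : set R := [set t : R | 0 <= t < 1].

Definition expi (theta : R) : R[i] := cos theta +i* sin theta.

Definition fourier_exp (n : nat) (x : R) : R[i] := expi (2 * pi * n%:R * x).

Definition singular nu : Prop :=
  exists N : set R, [/\ measurable N, lebesgue_measure N = 0%E & nu (~` N) = 0%E].

Definition aux_seq nu : nat -> R -> R[i] :=
  triangular_rec fourier_exp
    (fun n k g x => inner nu (fourier_exp n) (fourier_exp k) * g x).

Lemma aux_seqE nu n :
  aux_seq nu n = fourier_exp n -
    \sum_(k < n) (fun x => inner nu (fourier_exp n) (fourier_exp k) * aux_seq nu k x).
Proof. exact: triangular_recE. Qed.

End OneVariable.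

HB.instance Definition _ {d1 d2 : measure_display} (T1 : measurableType d1)
    (T2 : measurableType d2) :=
  isMeasurableFun.Build _ _ (T1 * T2)%type T1 (@fst T1 T2) measurable_fst.

Section Slices.
Context {disp : measure_display} {X : measurableType disp} {R : realType}.
Implicit Types (mu : probability (X * R)%type R).
Implicit Types (gam : R.-pker X ~> R).

Definition marginal mu : probability X R := distribution mu (@fst X R).

(* gam is a version of the Rokhlin disintegration of mu over its marginal, with
   gam x concentrated on [0,1) for x in D = [0,1)^(k-1). *)
Definition slice_measures (D : set X) mu gam : Prop :=
  (forall x, D x -> gam x Ico01 = 1%E) /\
  (forall h : X * R -> \bar R,
    measurable_fun setT h -> (forall z, (0 <= h z)%E) ->
    (\int[mu]_(z in setT) h z =
     \int[marginal mu]_(x in setT) \int[gam x]_(t in setT) h (x, t))%E).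

(* R(n,k), with gam the slice measures in the variable x_k. *)
Definition slice_op gam (n : nat) (h : X * R -> R[i]) : X -> R[i] :=
  fun x => cintegral (gam x) (fun t => h (x, t) * expi (- (2 * pi * n%:R * t))).

(* G(n,k), see [kaczmarz_opE]. *)
Definition kaczmarz_op mu gam (n : nat) (h : X * R -> R[i]) :
    X -> R[i] :=
  triangular_rec (fun n => slice_op gam n h)
    (fun n j u =>
       slice_op gam n (adjoint mu (marginal mu) (slice_op gam j) u)) n.

Lemma kaczmarz_opE mu gam n h :
  kaczmarz_op mu gam n h = slice_op gam n h -
    \sum_(j < n) slice_op gam n
      (adjoint mu (marginal mu) (slice_op gam j) (kaczmarz_op mu gam j h)).
Proof. exact: triangular_recE. Qed.

End Slices.

(* [box R m] is R^(m+1), nested as (..(R * R) * ..) * R, and [cube R m] is its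
   subset [0,1)^(m+1). *)
Fixpoint box_sig (R : realType) (m : nat) :
    {disp : measure_display & measurableType disp} :=
  if m is m'.+1 then
    existT _ _ ((projT2 (box_sig R m') * R)%type : measurableType _)
  else existT _ _ (R : measurableType _).

Definition box (R : realType) (m : nat) : measurableType (projT1 (box_sig R m)) :=
  projT2 (box_sig R m).

Fixpoint cube (R : realType) (m : nat) : set (box R m) :=
  if m is m'.+1 return set (box R m) then @cube R m' `*` Ico01
  else Ico01.
Arguments cube R m : clear implicits.

Section Iterated.
Context {R : realType}.

(* gam m is the family of slice measures gamma^{x_1,...,x_(m+1)} in the variable
   x_(m+2); for mu on box R M only m < M matters. *)
Variable gam : forall m : nat, R.-pker (box R m) ~> R.

Fixpoint iterated_slice_measures (m : nat) : probability (box R m) R -> Prop :=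
  if m is m'.+1 return probability (box R m) R -> Prop then
    fun mu => slice_measures (cube R m') mu (gam m') /\
              iterated_slice_measures (marginal mu)
  else fun _ => True.

(* For m = 0 this is singularity on [0,1), so that m = 1 gives the base case
   d = 2 of slice singularity. *)
Fixpoint slice_singular (m : nat) : probability (box R m) R -> Prop :=
  if m is m'.+1 return probability (box R m) R -> Prop then
    fun mu => {ae marginal mu, forall x, singular (gam m' x)} /\
              slice_singular (marginal mu)
  else fun mu => singular mu.

(* The multi-index (n_1, ..., n_d) is given by n 0 = n_1, ..., n d.-1 = n_d.
   Unfolding gives <G(n_2,2) ... G(n_d,d) f, g_(n_1)>. *)
Fixpoint fourier_coef (n : nat -> nat) (m : nat) :
    probability (box R m) R -> (box R m -> R[i]) -> R[i] :=
  if m is m'.+1 return probability (box R m) R -> (box R m -> R[i]) -> R[i] then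
    fun mu f => fourier_coef n (marginal mu) (kaczmarz_op mu (gam m') (n m) f)
  else fun mu f => inner mu f (aux_seq mu (n 0%N)).

Fixpoint aux_prod (n : nat -> nat) (m : nat) :
    probability (box R m) R -> box R m -> R[i] :=
  if m is m'.+1 return probability (box R m) R -> box R m -> R[i] then
    fun mu z => aux_seq (gam m' z.1) (n m) z.2 * aux_prod n (marginal mu) z.1
  else fun mu => aux_seq mu (n 0%N).

End Iterated.

(* Main.v *)
(* One variable.  The residual of the Kaczmarz algorithm after [n] steps satisfies
   [|f|^2 = sum_(k < n) |<f, g_k>|^2 + |residual_n|^2], so the auxiliary sequence is
   Parseval iff all residuals vanish in the limit.  The functions with vanishing
   residual form a closed subspace; if it contains [e_(-1)] it is invariant under
   multiplication by [e_1] and [e_(-1)], hence it is everything.  For [e_(-1)] the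
   coefficients [<e_(-1), g_k>] are the Taylor coefficients of [b(z) / z], where
   [1 / (1 - b)] is the Cauchy transform [Phi] of the measure, and
   [1 - |b|^2 = P |1 - b|^2] with [P = 2 Re Phi - 1] the Poisson integral.  As
   [|1 - b| <= 2], the residual is bounded by the integral of [min(1, 4 P)] over a
   circle of radius [r < 1], and for a singular measure this tends to [0] as
   [r -> 1]: [P] is uniformly small off a neighbourhood of small Lebesgue measure
   of a set carrying almost all the mass.

   Several variables.  The adjoint of [R(j, k)] is [h |-> h e_j], so the recursions of
   [G(n, k)] and of the auxiliary sequence match and [G(n, k) f] is the slice-wise
   inner product with [g_n] almost everywhere.  Both claims follow by disintegration
   and induction on the number of variables. *)
Require Import Defs.
From HB Require Import structures.
From mathcomp Require Import all_boot all_order all_algebra.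
From mathcomp Require Import complex.
From mathcomp Require Import ring lra.
From mathcomp Require Import all_classical all_reals all_analysis.
From mathcomp Require Import measurable_realfun lebesgue_measure probability kernel.

Set Implicit Arguments.
Unset Strict Implicit.
Unset Printing Implicit Defensive.

Import Order.TTheory GRing.Theory Num.Theory.
Import numFieldNormedType.Exports.

Local Open Scope classical_set_scope.
Local Open Scope ring_scope.
Local Open Scope complex_scope.

(** * Complex-valued square-integrable functions *)

(** No analytic function and no boundary value occurs. The function 1 - b is replaced by its Taylor
    polynomial [apoly b N], for which (1 - b) Phi = 1 holds up to an error of size r^(N+1) / (1 -
    r). Since [N] is chosen after [r], this error is harmless, and on the circle only the
    orthogonality of finitely many exponentials is needed. Invariance under e_1 and e_(-1) is
    exploited without a density theorem for trigonometric polynomials: the bounded functions that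
    preserve the subspace under multiplication form an algebra closed under bounded pointwise
    limits. It contains the cosine and the sine, hence by explicit polynomials the indicators of
    half-lines, hence those of all Borel sets, and simple functions finish the argument. With
    several variables the obstacle is null sets: the sections of an L^2 function are
    square-integrable, the slices singular, and the adjoint determined, only almost everywhere.
    Uniform bounds and joint measurability of the auxiliary functions of all slices keep the
    products in L^2. *)

Definition sqn {R : realType} (z : R[i]) : R := complex.Re z ^+ 2 + complex.Im z ^+ 2.

Section ComplexNumbers.
Context {R : realType}.
Implicit Types z w : R[i].

Lemma normc_sqn z : Normc.normc z ^+ 2 = sqn z.
Proof. by case: z => a b /=; rewrite sqr_sqrtr// addr_ge0// sqr_ge0. Qed.

Lemma sqn_ge0 z : 0 <= sqn z.
Proof. by rewrite addr_ge0// sqr_ge0. Qed.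

Lemma sqn0 : sqn (0 : R[i]) = 0.
Proof. by rewrite /sqn /= expr0n addr0. Qed.

Lemma sqn_eq0 z : sqn z = 0 -> z = 0.
Proof.
case: z => a b /eqP; rewrite paddr_eq0 ?sqr_ge0// !sqrf_eq0 /=.
by move=> /andP[/eqP-> /eqP->].
Qed.

Lemma ReM z w : complex.Re (z * w) =
  complex.Re z * complex.Re w - complex.Im z * complex.Im w.
Proof. by case: z w => [a b] [c d]. Qed.

Lemma ImM z w : complex.Im (z * w) =
  complex.Re z * complex.Im w + complex.Im z * complex.Re w.
Proof. by case: z w => [a b] [c d]. Qed.

Lemma ReD z w : complex.Re (z + w) = complex.Re z + complex.Re w.
Proof. by case: z w => [a b] [c d]. Qed.

Lemma ImD z w : complex.Im (z + w) = complex.Im z + complex.Im w.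
Proof. by case: z w => [a b] [c d]. Qed.

Lemma ReN z : complex.Re (- z) = - complex.Re z.
Proof. by case: z. Qed.

Lemma ImN z : complex.Im (- z) = - complex.Im z.
Proof. by case: z. Qed.

Lemma ReJ z : complex.Re z^* = complex.Re z.
Proof. by case: z. Qed.

Lemma ImJ z : complex.Im z^* = - complex.Im z.
Proof. by case: z. Qed.

Definition ReImE := (ReM, ImM, ReD, ImD, ReN, ImN, ReJ, ImJ).

Lemma eq_Re_Im z w :
  complex.Re z = complex.Re w -> complex.Im z = complex.Im w -> z = w.
Proof. by case: z w => [a b] [c d] /= -> ->. Qed.

Lemma conjcM z w : (z * w)^* = z^* * w^*.
Proof. by apply: eq_Re_Im; rewrite !ReImE; ring. Qed.

Lemma sqnM z w : sqn (z * w) = sqn z * sqn w.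
Proof. by rewrite /sqn !ReImE; ring. Qed.

Lemma sqnJ z : sqn z^* = sqn z.
Proof. by rewrite /sqn !ReImE; ring. Qed.

Lemma sqnD_le z w : sqn (z + w) <= 2 * sqn z + 2 * sqn w.
Proof.
rewrite /sqn !ReImE -subr_ge0.
set a := complex.Re z; set b := complex.Im z.
set c := complex.Re w; set d := complex.Im w.
rewrite (_ : _ - _ = (a - c) ^+ 2 + (b - d) ^+ 2); last by ring.
by rewrite addr_ge0// sqr_ge0.
Qed.

Lemma mulcJ z : z * z^* = (sqn z)%:C.
Proof.
by apply: eq_Re_Im; rewrite !ReImE /=; rewrite /sqn; ring.
Qed.

Lemma sqn_real (a : R) : sqn a%:C = a ^+ 2.
Proof. by rewrite /sqn /= expr0n addr0. Qed.

End ComplexNumbers.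

Section CMeasurable.
Context {disp : measure_display} {T : measurableType disp} {R : realType}.
Implicit Types f g : T -> R[i].

Lemma cmeasurable_cst (c : R[i]) : cmeasurable (fun _ : T => c).
Proof. by split; exact: measurable_cst. Qed.

Lemma cmeasurableD f g : cmeasurable f -> cmeasurable g ->
  cmeasurable (fun x => f x + g x).
Proof.
move=> [f1 f2] [g1 g2]; split.
- under eq_fun do rewrite ReD; exact: measurable_funD.
- under eq_fun do rewrite ImD; exact: measurable_funD.
Qed.

Lemma cmeasurableM f g : cmeasurable f -> cmeasurable g ->
  cmeasurable (fun x => f x * g x).
Proof.
move=> [f1 f2] [g1 g2]; split.
- by under eq_fun do rewrite ReM; apply: measurable_funB; exact: measurable_funM.
- by under eq_fun do rewrite ImM; apply: measurable_funD; exact: measurable_funM.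
Qed.

Lemma cmeasurableJ f : cmeasurable f -> cmeasurable (fun x => (f x)^*).
Proof.
move=> [f1 f2]; split; first by under eq_fun do rewrite ReJ.
by under eq_fun do rewrite ImJ; exact: measurable_funN.
Qed.

Lemma cmeasurable_sum (I : Type) (s : seq I) (F : I -> T -> R[i]) :
  (forall i, cmeasurable (F i)) -> cmeasurable (fun x => \sum_(i <- s) F i x).
Proof.
move=> mF; elim: s => [|i s IHs].
  by under eq_fun do rewrite big_nil; exact: cmeasurable_cst.
by under eq_fun do rewrite big_cons; exact: cmeasurableD.
Qed.

Lemma cmeasurableB f g : cmeasurable f -> cmeasurable g ->
  cmeasurable (fun x => f x - g x).
Proof.
move=> mf mg; have /(_ (-1)) m c := cmeasurableM (cmeasurable_cst c) mg.
by have := cmeasurableD mf m; under eq_fun do rewrite mulN1r.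
Qed.

Lemma measurable_sqn f : cmeasurable f -> measurable_fun setT (fun x => sqn (f x)).
Proof.
by move=> [f1 f2]; apply: measurable_funD; exact: measurable_funX.
Qed.

Lemma measurable_sqnE f : cmeasurable f ->
  measurable_fun setT (fun x => (sqn (f x))%:E).
Proof. by move=> /measurable_sqn /measurable_EFinP. Qed.

End CMeasurable.

Lemma cmeasurable_comp {d1 d2} {T1 : measurableType d1} {T2 : measurableType d2}
    {R : realType} (f : T2 -> R[i]) (h : T1 -> T2) :
  cmeasurable f -> measurable_fun setT h -> cmeasurable (fun x => f (h x)).
Proof. by move=> [f1 f2] mh; split; [exact: measurableT_comp f1 mh | exact: measurableT_comp f2 mh]. Qed.

Definition cintegrable {disp} {T : measurableType disp} {R : realType}
    (mu : {measure set T -> \bar R}) (f : T -> R[i]) : Prop :=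
  mu.-integrable setT (fun x => (complex.Re (f x))%:E) /\
  mu.-integrable setT (fun x => (complex.Im (f x))%:E).

Section CIntegral.
Context {disp : measure_display} {T : measurableType disp} {R : realType}.
Variable mu : {measure set T -> \bar R}.
Implicit Types f g : T -> R[i].

Lemma integrableZlE (r : R) (f : T -> R) :
  mu.-integrable setT (EFin \o f) -> mu.-integrable setT (EFin \o (fun x => r * f x)).
Proof. exact: (integrableZl measurableT). Qed.

Lemma integrableDE (f g : T -> R) : mu.-integrable setT (EFin \o f) ->
  mu.-integrable setT (EFin \o g) ->
  mu.-integrable setT (EFin \o (fun x => f x + g x)).
Proof. exact: (integrableD measurableT). Qed.

Lemma integrableBE (f g : T -> R) : mu.-integrable setT (EFin \o f) ->
  mu.-integrable setT (EFin \o g) ->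
  mu.-integrable setT (EFin \o (fun x => f x - g x)).
Proof. exact: (integrableB measurableT). Qed.

Lemma cintegrableD f g : cintegrable mu f -> cintegrable mu g ->
  cintegrable mu (fun x => f x + g x).
Proof.
move=> [f1 f2] [g1 g2]; split.
- under eq_fun do rewrite ReD EFinD; exact: integrableD.
- under eq_fun do rewrite ImD EFinD; exact: integrableD.
Qed.

Lemma cintegrableZ (c : R[i]) f : cintegrable mu f ->
  cintegrable mu (fun x => c * f x).
Proof.
move=> [f1 f2]; split.
- under eq_fun do rewrite ReM EFinB !EFinM.
  by apply: integrableB => //; exact: integrableZl.
- under eq_fun do rewrite ImM EFinD !EFinM.
  by apply: integrableD => //; exact: integrableZl.
Qed.

Lemma cintegralD f g : cintegrable mu f -> cintegrable mu g ->
  cintegral mu (fun x => f x + g x) = cintegral mu f + cintegral mu g.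
Proof.
move=> [f1 f2] [g1 g2]; rewrite /cintegral; apply: eq_Re_Im; rewrite ?ReD ?ImD /=.
- by under eq_Rintegral do rewrite ReD; rewrite RintegralD.
- by under eq_Rintegral do rewrite ImD; rewrite RintegralD.
Qed.

Lemma cintegralZ (c : R[i]) f : cintegrable mu f ->
  cintegral mu (fun x => c * f x) = c * cintegral mu f.
Proof.
move=> [f1 f2]; rewrite /cintegral; apply: eq_Re_Im; rewrite ?ReM ?ImM /=.
- under eq_Rintegral do rewrite ReM.
  by rewrite RintegralB ?RintegralZl//; exact: integrableZlE.
- under eq_Rintegral do rewrite ImM.
  by rewrite RintegralD ?RintegralZl//; exact: integrableZlE.
Qed.

Lemma cintegralJ f : cintegrable mu f ->
  cintegral mu (fun x => (f x)^*) = (cintegral mu f)^*.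
Proof.
move=> [f1 f2]; rewrite /cintegral; apply: eq_Re_Im; rewrite ?ReJ ?ImJ /=.
  by under eq_Rintegral do rewrite ReJ.
under eq_Rintegral do rewrite ImJ -mulN1r.
by rewrite RintegralZl// mulN1r.
Qed.

Lemma cintegrable0 : cintegrable mu (fun _ => 0).
Proof. by split; exact: integrable0. Qed.

Lemma cintegral0 : cintegral mu (fun _ => 0) = 0.
Proof. by rewrite /cintegral /= /Rintegral integral0. Qed.

Lemma cintegrable_sum (I : Type) (s : seq I) (F : I -> T -> R[i]) :
  (forall i, cintegrable mu (F i)) ->
  cintegrable mu (fun x => \sum_(i <- s) F i x).
Proof.
move=> mF; elim: s => [|i s IHs].
  by under eq_fun do rewrite big_nil; exact: cintegrable0.
by under eq_fun do rewrite big_cons; exact: cintegrableD.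
Qed.

Lemma cintegral_sum (I : Type) (s : seq I) (F : I -> T -> R[i]) :
  (forall i, cintegrable mu (F i)) ->
  cintegral mu (fun x => \sum_(i <- s) F i x) = \sum_(i <- s) cintegral mu (F i).
Proof.
move=> mF; elim: s => [|i s IHs].
  by under [X in cintegral _ X]eq_fun do rewrite big_nil; rewrite big_nil cintegral0.
under [X in cintegral _ X]eq_fun do rewrite big_cons.
by rewrite cintegralD ?IHs ?big_cons//; exact: cintegrable_sum.
Qed.

Lemma ae_eq_cintegral f g : cmeasurable f -> cmeasurable g ->
  {ae mu, forall x, f x = g x} -> cintegral mu f = cintegral mu g.
Proof.
move=> [f1 f2] [g1 g2] fg; rewrite /cintegral /Rintegral.
congr (fine _ +i* fine _); apply: ae_eq_integral => //;
  do ?[exact/measurable_EFinP]; by apply: filterS fg => x -> _.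
Qed.

End CIntegral.

Section L2Theory.
Context {disp : measure_display} {T : measurableType disp} {R : realType}.
Variable mu : {measure set T -> \bar R}.
Implicit Types f g h : T -> R[i].

Definition normsq f : R := fine (L2normsq mu f).

Lemma L2normsqE f : L2normsq mu f = (\int[mu]_x (sqn (f x))%:E)%E.
Proof. by apply: eq_integral => x _; rewrite normc_sqn. Qed.

Lemma L2normsq_ge0 f : (0 <= L2normsq mu f)%E.
Proof. by apply: integral_ge0 => x _; rewrite lee_fin sqr_ge0. Qed.

Lemma L2_measurable f : L2 mu f -> cmeasurable f.
Proof. by case. Qed.

Lemma L2_normsqE f : L2 mu f -> L2normsq mu f = (normsq f)%:E.
Proof. by move=> [_ ?]; rewrite /normsq fineK// ge0_fin_numE// L2normsq_ge0. Qed.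

Lemma normsq_ge0 f : 0 <= normsq f.
Proof. by rewrite fine_ge0// L2normsq_ge0. Qed.

Lemma L2P f : L2 mu f <->
  cmeasurable f /\ mu.-integrable setT (fun x => (sqn (f x))%:E).
Proof.
split=> [[mf fi]|[mf /integrableP[_ fi]]]; split => //.
- apply/integrableP; split; first exact: measurable_sqnE.
  under eq_integral do rewrite gee0_abs ?lee_fin ?sqn_ge0//.
  by rewrite -L2normsqE.
- rewrite L2normsqE; apply: le_lt_trans fi.
  by under [leRHS]eq_integral do rewrite gee0_abs ?lee_fin ?sqn_ge0//.
Qed.

Lemma L2_dominated f g (c : R) : L2 mu f -> cmeasurable g ->
  (forall x, sqn (g x) <= c * sqn (f x)) -> L2 mu g.
Proof.
move=> /L2P[mf fi] mg gf; apply/L2P; split=> //.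
apply: (@le_integrable _ _ _ mu _ _ _ (fun x => c%:E * (sqn (f x))%:E)%E) => //.
- exact: measurable_sqnE.
- move=> x _; rewrite -EFinM gee0_abs ?lee_fin ?sqn_ge0// ger0_norm//.
  exact: le_trans (sqn_ge0 _) (gf x).
- exact: integrableZl.
Qed.

Lemma L2M_bounded f g (c : R) : L2 mu f -> cmeasurable g ->
  (forall x, sqn (g x) <= c) -> L2 mu (fun x => g x * f x).
Proof.
move=> Lf mg gc; apply: (@L2_dominated f _ c) => //.
  by apply: cmeasurableM => //; exact: L2_measurable.
by move=> x; rewrite sqnM ler_wpM2r// sqn_ge0.
Qed.

Lemma L2Z (c : R[i]) f : L2 mu f -> L2 mu (fun x => c * f x).
Proof. by move=> Lf; apply: (@L2M_bounded _ _ (sqn c)) => //; exact: cmeasurable_cst. Qed.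

Lemma L2D f g : L2 mu f -> L2 mu g -> L2 mu (fun x => f x + g x).
Proof.
move=> /L2P[mf fi] /L2P[mg gi].
have mfg : cmeasurable (fun x => f x + g x) by exact: cmeasurableD.
apply/L2P; split => //.
apply: (@le_integrable _ _ _ mu _ _ _
  (fun x => 2%:E * (sqn (f x))%:E + 2%:E * (sqn (g x))%:E)%E) => //.
- exact: measurable_sqnE.
- move=> x _; rewrite -!EFinM -EFinD !gee0_abs ?lee_fin ?sqn_ge0//.
    exact: sqnD_le.
  by rewrite addr_ge0// mulr_ge0// sqn_ge0.
- by apply: integrableD => //; exact: integrableZl.
Qed.

Lemma L2B f g : L2 mu f -> L2 mu g -> L2 mu (fun x => f x - g x).
Proof.
move=> Lf /(L2Z (-1)) Lg; have := L2D Lf Lg.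
by under eq_fun do rewrite mulN1r.
Qed.

Lemma L20 : L2 mu (fun _ => 0).
Proof.
by apply/L2P; split; [exact: cmeasurable_cst | rewrite sqn0; exact: integrable0].
Qed.

Lemma L2_sum (I : Type) (s : seq I) (F : I -> T -> R[i]) :
  (forall i, L2 mu (F i)) -> L2 mu (fun x => \sum_(i <- s) F i x).
Proof.
move=> mF; elim: s => [|i s IHs]; first by under eq_fun do rewrite big_nil; exact: L20.
by under eq_fun do rewrite big_cons; exact: L2D.
Qed.

Lemma L2_inner_integrable f g : L2 mu f -> L2 mu g ->
  cintegrable mu (fun x => f x * (g x)^*).
Proof.
move=> /L2P[mf fi] /L2P[mg gi].
have [m1 m2] := cmeasurableM mf (cmeasurableJ mg).
have ifg : mu.-integrable setT (fun x => (sqn (f x))%:E + (sqn (g x))%:E)%E.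
  by apply: integrableD.
have sqab (a b : R) : `|a * b| <= (a ^+ 2 + b ^+ 2) / 2.
  have := sqr_ge0 (`|a| - `|b|); rewrite sqrrB !real_normK ?num_real// normrM; lra.
split; apply: (le_integrable measurableT _ _ ifg); do ?exact/measurable_EFinP;
  move=> x _; rewrite -EFinD /= lee_fin [leRHS]ger0_norm ?(addr_ge0 (sqn_ge0 _) (sqn_ge0 _))//.
- rewrite ReM ReJ ImJ mulrN opprK (le_trans (ler_normD _ _))// /sqn.
  have := sqab (complex.Re (f x)) (complex.Re (g x)).
  have := sqab (complex.Im (f x)) (complex.Im (g x)).
  have := sqr_ge0 (complex.Re (f x)); have := sqr_ge0 (complex.Re (g x)).
  have := sqr_ge0 (complex.Im (f x)); have := sqr_ge0 (complex.Im (g x)).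
  lra.
- rewrite ImM ReJ ImJ mulrN (le_trans (ler_normD _ _))// normrN /sqn.
  have := sqab (complex.Re (f x)) (complex.Im (g x)).
  have := sqab (complex.Im (f x)) (complex.Re (g x)).
  have := sqr_ge0 (complex.Re (f x)); have := sqr_ge0 (complex.Re (g x)).
  have := sqr_ge0 (complex.Im (f x)); have := sqr_ge0 (complex.Im (g x)).
  lra.
Qed.

Lemma innerDl f g h : L2 mu f -> L2 mu g -> L2 mu h ->
  inner mu (fun x => f x + g x) h = inner mu f h + inner mu g h.
Proof.
move=> Lf Lg Lh; rewrite /inner; under [X in cintegral _ X]eq_fun do rewrite mulrDl.
by apply: cintegralD; exact: L2_inner_integrable.
Qed.

Lemma innerZl (c : R[i]) f h : L2 mu f -> L2 mu h ->
  inner mu (fun x => c * f x) h = c * inner mu f h.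
Proof.
move=> Lf Lh; rewrite /inner; under [X in cintegral _ X]eq_fun do rewrite -mulrA.
by apply: cintegralZ; exact: L2_inner_integrable.
Qed.

Lemma innerJ f h : L2 mu f -> L2 mu h -> inner mu h f = (inner mu f h)^*.
Proof.
move=> Lf Lh; rewrite /inner -cintegralJ; last exact: L2_inner_integrable.
by congr cintegral; apply/funext => x; apply: eq_Re_Im; rewrite !ReImE; ring.
Qed.

Lemma innerBl f g h : L2 mu f -> L2 mu g -> L2 mu h ->
  inner mu (fun x => f x - g x) h = inner mu f h - inner mu g h.
Proof.
move=> Lf Lg Lh; under [X in inner _ X]eq_fun do rewrite -mulN1r.
by rewrite innerDl ?innerZl ?mulN1r//; exact: L2Z.
Qed.

Lemma inner_suml (I : Type) (s : seq I) (F : I -> T -> R[i]) h :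
  (forall i, L2 mu (F i)) -> L2 mu h ->
  inner mu (fun x => \sum_(i <- s) F i x) h = \sum_(i <- s) inner mu (F i) h.
Proof.
move=> LF Lh; rewrite /inner; under [X in cintegral _ X]eq_fun do rewrite mulr_suml.
by apply: cintegral_sum => i; exact: L2_inner_integrable.
Qed.

Lemma innerDr f g h : L2 mu f -> L2 mu g -> L2 mu h ->
  inner mu h (fun x => f x + g x) = inner mu h f + inner mu h g.
Proof.
move=> Lf Lg Lh; rewrite (innerJ (L2D Lf Lg) Lh) innerDl// (innerJ Lf Lh) (innerJ Lg Lh).
by rewrite rmorphD.
Qed.

Lemma innerZr (c : R[i]) f h : L2 mu f -> L2 mu h ->
  inner mu h (fun x => c * f x) = c^* * inner mu h f.
Proof.
by move=> Lf Lh; rewrite (innerJ (L2Z c Lf) Lh) innerZl// (innerJ Lf Lh) rmorphM.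
Qed.

Lemma innerBr f g h : L2 mu f -> L2 mu g -> L2 mu h ->
  inner mu h (fun x => f x - g x) = inner mu h f - inner mu h g.
Proof.
move=> Lf Lg Lh; rewrite (innerJ (L2B Lf Lg) Lh) innerBl// (innerJ Lf Lh) (innerJ Lg Lh).
by rewrite rmorphB.
Qed.

Lemma inner_sumr (I : Type) (s : seq I) (F : I -> T -> R[i]) h :
  (forall i, L2 mu (F i)) -> L2 mu h ->
  inner mu h (fun x => \sum_(i <- s) F i x) = \sum_(i <- s) inner mu h (F i).
Proof.
move=> LF Lh; rewrite (innerJ (L2_sum s LF) Lh) inner_suml// rmorph_sum.
by apply: eq_bigr => i _; rewrite (innerJ (LF i) Lh).
Qed.

Lemma inner_self f : inner mu f f = (normsq f)%:C.
Proof.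
rewrite /inner /cintegral /normsq L2normsqE; apply: eq_Re_Im => /=.
  by apply: eq_Rintegral => x _; rewrite mulcJ.
by under eq_Rintegral do rewrite mulcJ /=; rewrite /Rintegral integral0.
Qed.

Lemma normsqZ (c : R[i]) f : L2 mu f ->
  normsq (fun x => c * f x) = sqn c * normsq f.
Proof.
move=> Lf; apply: complexI; rewrite -inner_self innerZl ?innerZr//; last exact: L2Z.
by rewrite mulrA mulcJ inner_self rmorphM.
Qed.

Lemma normsqB f g : L2 mu f -> L2 mu g ->
  normsq (fun x => f x - g x) =
  normsq f + normsq g - 2 * complex.Re (inner mu f g).
Proof.
move=> Lf Lg; apply: complexI; rewrite -inner_self innerBl ?innerBr//; last exact: L2B.
rewrite !inner_self (innerJ Lf Lg); case: (inner mu f g) => a b.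
by apply: eq_Re_Im; rewrite !ReImE /=; ring.
Qed.

Lemma normsqD f g : L2 mu f -> L2 mu g ->
  normsq (fun x => f x + g x) =
  normsq f + normsq g + 2 * complex.Re (inner mu f g).
Proof.
move=> Lf Lg; apply: complexI; rewrite -inner_self innerDl ?innerDr//; last exact: L2D.
rewrite !inner_self (innerJ Lf Lg); case: (inner mu f g) => a b.
by apply: eq_Re_Im; rewrite !ReImE /=; ring.
Qed.

Lemma normsqD_le f g : L2 mu f -> L2 mu g ->
  normsq (fun x => f x + g x) <= 2 * normsq f + 2 * normsq g.
Proof.
move=> Lf Lg; have := normsq_ge0 (fun x => f x - g x).
by rewrite normsqB// normsqD//; lra.
Qed.

Lemma le_normsq f g : L2 mu f -> L2 mu g ->
  (forall x, sqn (f x) <= sqn (g x)) -> normsq f <= normsq g.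
Proof.
move=> /L2P[mf fi] /L2P[mg gi] fg; rewrite /normsq !L2normsqE.
by apply: le_Rintegral => // x _; exact: fg.
Qed.

Lemma eq_normsq f g : (forall x, sqn (f x) = sqn (g x)) -> normsq f = normsq g.
Proof.
by move=> fg; rewrite /normsq !L2normsqE; congr fine; apply: eq_integral => x _; rewrite fg.
Qed.

Lemma ae_eq_inner f f' g : cmeasurable f -> cmeasurable f' -> cmeasurable g ->
  {ae mu, forall x, f x = f' x} -> inner mu f g = inner mu f' g.
Proof.
move=> mf mf' mg ff'; apply: ae_eq_cintegral.
- by apply: cmeasurableM => //; exact: cmeasurableJ.
- by apply: cmeasurableM => //; exact: cmeasurableJ.
- by apply: filterS ff' => x ->.
Qed.

Lemma L2normsq_eq0 f : cmeasurable f -> L2normsq mu f = 0%E ->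
  {ae mu, forall x, f x = 0}.
Proof.
move=> mf; rewrite L2normsqE => f0.
have : (\int[mu]_x `|(sqn (f x))%:E| = 0)%E.
  by under eq_integral do rewrite gee0_abs ?lee_fin ?sqn_ge0//.
move=> /(ae_eq_integral_abs mu measurableT (measurable_sqnE mf)).
by apply: filterS => x /(_ Logic.I) [] /sqn_eq0.
Qed.

Hypothesis mu1 : mu setT = 1%E.

Lemma integrable_cst1 (r : R) : mu.-integrable setT (fun _ => r%:E).
Proof.
apply/integrableP; split; first exact: measurable_cst.
by rewrite integral_cst// mu1 mule1 /= ltry.
Qed.

Lemma L2_bounded f (c : R) : cmeasurable f -> (forall x, sqn (f x) <= c) -> L2 mu f.
Proof.
move=> mf fc; apply/L2P; split => //.
apply: (le_integrable measurableT _ _ (integrable_cst1 c)).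
  exact: measurable_sqnE.
move=> x _; rewrite gee0_abs ?lee_fin ?sqn_ge0// ger0_norm//.
exact: le_trans (sqn_ge0 _) (fc x).
Qed.

Lemma cintegrable_cst (c : R[i]) : cintegrable mu (fun _ => c).
Proof. by split; exact: integrable_cst1. Qed.

Lemma cintegral_cst (c : R[i]) : cintegral mu (fun _ => c) = c.
Proof.
rewrite /cintegral !Rintegral_cst//; apply: eq_Re_Im => /=;
by rewrite mu1 /= mulr1.
Qed.

Lemma normsq_unimodular f : (forall x, sqn (f x) = 1) -> normsq f = 1.
Proof.
move=> f1; rewrite /normsq L2normsqE.
by under eq_integral do rewrite f1; rewrite integral_cst// mu1 mule1.
Qed.

Lemma normsq_bounded f (c : R) : L2 mu f -> (forall x, sqn (f x) <= c) ->
  normsq f <= c.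
Proof.
move=> /L2P[mf fi] fc; rewrite /normsq L2normsqE.
apply: (@le_trans _ _ (\int[mu]_x c)).
  by apply: le_Rintegral => //; exact: integrable_cst1.
by rewrite Rintegral_cst// mu1 mulr1.
Qed.

(** Cauchy-Schwarz against the constant 1, read off from |f - <f, 1> 1|^2 >= 0. *)
Lemma sqn_cintegral_le f : L2 mu f -> sqn (cintegral mu f) <= normsq f.
Proof.
move=> Lf; pose one := fun _ : T => 1 : R[i].
have L1 : L2 mu one.
  by apply: (@L2_bounded _ 1); [exact: cmeasurable_cst|rewrite /sqn /= expr0n expr1n addr0].
have fE : cintegral mu f = inner mu f one.
  by congr cintegral; apply/funext => x; rewrite /one rmorph1 mulr1.
have := normsq_ge0 (fun x => f x - inner mu f one * one x).
rewrite normsqB//; last exact: L2Z.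
rewrite normsqZ// innerZr// fE (mulrC _^*) mulcJ /=.
rewrite (@normsq_unimodular one); first lra.
by move=> x; rewrite /sqn /= expr0n expr1n addr0.
Qed.

End L2Theory.

(** * The Kaczmarz algorithm for unimodular functions *)

Section Kaczmarz.
Context {disp : measure_display} {T : measurableType disp} {R : realType}.
Variable mu : {measure set T -> \bar R}.
Hypothesis mu1 : mu setT = 1%E.
Variable e : nat -> T -> R[i].
Hypothesis me : forall n, cmeasurable (e n).
Hypothesis e1 : forall n x, sqn (e n x) = 1.
Implicit Types f g : T -> R[i].

(** The error of the Kaczmarz iteration: each step projects it onto the orthogonal complement of
    [e m], which has norm one. *)
Fixpoint residual f (n : nat) : T -> R[i] :=
  if n is m.+1 then
    fun x => residual f m x - inner mu (residual f m) (e m) * e m x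
  else f.

(** The auxiliary sequence of an arbitrary family; for [fourier_exp] it is convertible to
    [aux_seq]. *)
Definition gram_seq : nat -> T -> R[i] :=
  triangular_rec e (fun n k g x => inner mu (e n) (e k) * g x).

Lemma gram_seqE n : gram_seq n =
  fun x => e n x - \sum_(k < n) inner mu (e n) (e k) * gram_seq k x.
Proof.
by rewrite /gram_seq triangular_recE; rewrite fct_sumE.
Qed.

Lemma L2_unimodular n : L2 mu (e n).
Proof. by apply: (@L2_bounded _ _ _ mu mu1 _ 1) => // x; rewrite e1. Qed.

Lemma cmeasurable_gram_seq n : cmeasurable (gram_seq n).
Proof.
elim/ltn_ind: n => n IHn.
rewrite gram_seqE; apply: cmeasurableB => //.
have := @cmeasurable_sum _ T R 'I_n (index_enum 'I_n)
  (fun k x => inner mu (e n) (e k) * gram_seq k x); apply => k.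
by apply: cmeasurableM; [exact: cmeasurable_cst | exact: IHn].
Qed.

Lemma sqn_inner_unimodular_le f n : L2 mu f -> sqn (inner mu f (e n)) <= normsq mu f.
Proof.
move=> Lf; rewrite /inner (@le_trans _ _ (normsq mu (fun x => f x * (e n x)^*)))//.
  apply: sqn_cintegral_le => //; under eq_fun do rewrite mulrC.
  apply: (@L2M_bounded _ _ _ _ _ _ 1) => //; first exact: cmeasurableJ.
  by move=> x; rewrite sqnJ e1.
by rewrite (@eq_normsq _ _ _ _ _ f)// => x; rewrite sqnM sqnJ e1 mulr1.
Qed.

Lemma inner_unimodular_le1 n k : sqn (inner mu (e n) (e k)) <= 1.
Proof.
apply: le_trans (sqn_inner_unimodular_le k (L2_unimodular n)) _.
by rewrite normsq_unimodular.
Qed.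

Lemma L2_gram_seq n : L2 mu (gram_seq n).
Proof.
elim/ltn_ind: n => n IHn.
rewrite gram_seqE; apply: L2B; first exact: L2_unimodular.
have := @L2_sum _ T R mu 'I_n (index_enum 'I_n)
  (fun k x => inner mu (e n) (e k) * gram_seq k x); apply => k.
by apply: L2Z; exact: IHn.
Qed.

Lemma L2_residual f n : L2 mu f -> L2 mu (residual f n).
Proof.
move=> Lf; elim: n => //= n IHn; apply: L2B => //; apply: L2Z.
exact: L2_unimodular.
Qed.

Lemma residualE f n x : residual f n x =
  f x - \sum_(k < n) inner mu (residual f k) (e k) * e k x.
Proof.
elim: n => [|n IHn]; first by rewrite big_ord0 subr0.
by rewrite big_ord_recr /= IHn opprD addrA.
Qed.

(** Pairing the expansion [residualE] with [e n] and moving the sum to the second slot reproduces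
    the recursion that defines [gram_seq n]. *)
Lemma inner_residual f n : L2 mu f ->
  inner mu (residual f n) (e n) = inner mu f (gram_seq n).
Proof.
move=> Lf; elim/ltn_ind: n => n IHn.
rewrite gram_seqE; have -> : residual f n = fun x =>
    f x - \sum_(k < n) inner mu (residual f k) (e k) * e k x.
  by apply/funext => x; rewrite residualE.
have Le := L2_unimodular; have Lg := L2_gram_seq.
rewrite innerBl//; last by apply: L2_sum => k; exact: L2Z.
rewrite innerBr//; last by apply: L2_sum => k; exact: L2Z.
congr (_ - _); rewrite inner_suml//; last by move=> k; exact: L2Z.
rewrite inner_sumr//; last by move=> k; exact: L2Z.
apply: eq_bigr => k _; rewrite innerZl// innerZr// -IHn//.
by rewrite (innerJ (Le n) (Le k)) mulrC; congr (_ * _); rewrite -innerJ.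
Qed.

Lemma normsq_residualS f n : L2 mu f -> normsq mu (residual f n.+1) =
  normsq mu (residual f n) - sqn (inner mu (residual f n) (e n)).
Proof.
move=> Lf /=; have Lr := L2_residual n Lf; have Le := L2_unimodular n.
rewrite normsqB//; last exact: L2Z.
rewrite normsqZ// innerZr// (mulrC _^*) mulcJ /= (normsq_unimodular mu1 (e1 n)).
ring.
Qed.

Lemma inner_residualS f n : L2 mu f -> inner mu (residual f n.+1) (e n) = 0.
Proof.
move=> Lf /=; have Lr := L2_residual n Lf; have Le := L2_unimodular n.
rewrite innerBl//; last exact: L2Z.
by rewrite innerZl// inner_self (normsq_unimodular mu1 (e1 n)) mulr1 subrr.
Qed.

(** Pythagoras at each step, telescoped. *)
Lemma sum_inner_gram f n : L2 mu f ->
  \sum_(0 <= k < n) sqn (inner mu f (gram_seq k)) =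
  normsq mu f - normsq mu (residual f n).
Proof.
move=> Lf; elim: n => [|n IHn]; first by rewrite big_geq//= subrr.
rewrite big_nat_recr//= IHn normsq_residualS// -inner_residual//.
ring.
Qed.

Lemma normsq_residual_le f m n : L2 mu f -> (m <= n)%N ->
  normsq mu (residual f n) <= normsq mu (residual f m).
Proof.
move=> Lf /subnKC <-; elim: (n - m)%N => [|k IHk]; first by rewrite addn0.
rewrite addnS; apply: le_trans IHk.
by rewrite normsq_residualS// gerBl sqn_ge0.
Qed.

Lemma residual_lin (c : R[i]) f g n : L2 mu f -> L2 mu g ->
  residual (fun x => c * f x + g x) n =
  (fun x => c * residual f n x + residual g n x).
Proof.
move=> Lf Lg; elim: n => //= n ->; apply/funext => x.
have Le := L2_unimodular n.
have Lfr := L2_residual n Lf; have Lgr := L2_residual n Lg.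
rewrite innerDl ?innerZl//; last exact: L2Z.
ring.
Qed.

(** One [n] per [eps] is enough, because the norms of the residuals decrease. *)
Definition vanishing f := L2 mu f /\
  forall eps : R, 0 < eps -> exists n, normsq mu (residual f n) <= eps.

Lemma vanishing_lin (c : R[i]) f g : vanishing f -> vanishing g ->
  vanishing (fun x => c * f x + g x).
Proof.
move=> [Lf vf] [Lg vg]; split; first by apply: L2D => //; exact: L2Z.
move=> eps eps0.
(* From |c a + b|^2 <= 2 |c|^2 |a|^2 + 2 |b|^2, each summand receives half of [eps]; the [+ 1] keeps
   the divisor positive when [c] is 0. *)
have c0 : 0 < 4 * (sqn c + 1) by rewrite mulr_gt0// ltr_wpDl// sqn_ge0.
have [n1 h1] := vf _ (divr_gt0 eps0 c0).
have [n2 h2] := vg (eps / 4) ltac:(by rewrite divr_gt0).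
have Lfr n := L2_residual n Lf; have Lgr n := L2_residual n Lg.
exists (maxn n1 n2); rewrite residual_lin//.
apply: le_trans (normsqD_le _ _) _ => //; first exact: L2Z.
rewrite normsqZ//.
have /le_trans/(_ h1) := normsq_residual_le Lf (leq_maxl n1 n2).
rewrite ler_pdivlMr// => h1'.
have /le_trans/(_ h2) h2' := normsq_residual_le Lg (leq_maxr n1 n2).
move: h1' h2'; set a := normsq _ _; set b := normsq _ _.
have : 0 <= a by exact: normsq_ge0.
lra.
Qed.

(** For fixed [n] the residual is a linear contraction of [f], so a small perturbation of [f]
    perturbs it little, uniformly in [n]. *)
Lemma vanishing_closed f : L2 mu f ->
  (forall eps : R, 0 < eps -> exists g, vanishing g /\
     normsq mu (fun x => f x - g x) <= eps) -> vanishing f.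
Proof.
move=> Lf fg; split => // eps eps0.
have [g [[Lg vg] fge]] := fg (eps / 4) ltac:(by rewrite divr_gt0).
have [n hn] := vg (eps / 4) ltac:(by rewrite divr_gt0).
exists n; have Lfg := L2B Lf Lg.
have -> : f = (fun x => 1 * g x + (f x - g x)).
  by apply/funext => x; rewrite mul1r addrC subrK.
rewrite residual_lin//.
under [X in normsq _ X]eq_fun do rewrite mul1r.
apply: le_trans (normsqD_le _ _) _; [exact: L2_residual..|].
have := normsq_residual_le Lfg (leq0n n).
rewrite /=; lra.
Qed.

Lemma vanishing0 : vanishing (fun _ => 0).
Proof.
split; first exact: L20.
move=> eps eps0; exists 0%N => /=.
by rewrite /normsq L2normsqE; under eq_integral do rewrite sqn0; rewrite integral0 ltW.
Qed.

(** The form in which closedness is used: |f - fn|^2 is dominated by 4 [G], so pointwise convergence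
    becomes convergence in norm. *)
Lemma vanishing_dominated (fn : nat -> T -> R[i]) f (G : T -> R) :
  (forall n, vanishing (fn n)) -> cmeasurable f ->
  mu.-integrable setT (fun x => (G x)%:E) ->
  (forall n x, sqn (fn n x) <= G x) -> (forall x, sqn (f x) <= G x) ->
  (forall x, sqn (f x - fn n x) @[n --> \oo] --> 0) ->
  vanishing f.
Proof.
move=> vfn mf iG fnG fG fnf.
have Lfn n : L2 mu (fn n) by case: (vfn n).
have Lf : L2 mu f.
  apply/L2P; split => //; apply: (le_integrable measurableT _ _ iG).
    exact: measurable_sqnE.
  move=> x _; rewrite !gee0_abs ?lee_fin ?sqn_ge0//.
  exact: le_trans (sqn_ge0 _) (fG x).
apply: vanishing_closed => // eps eps0.
have mfn n : cmeasurable (fn n) := L2_measurable (Lfn n).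
have [] := @dominated_convergence _ T R mu setT measurableT
  (fun n x => (sqn (f x - fn n x))%:E) (cst 0%E) (fun x => 4%:E * (G x)%:E)%E.
- by move=> n; apply: measurable_sqnE; exact: cmeasurableB.
- exact: measurable_cst.
- by apply: aeW => x _; apply: cvg_EFin; [exact: nearW | exact: fnf].
- exact: integrableZl.
- apply: aeW => x n _ /=; rewrite lee_fin ger0_norm ?sqn_ge0//.
  apply: le_trans (sqnD_le _ _) _; have := fnG n x; have := fG x.
  by rewrite /sqn ReN ImN !sqrrN; lra.
move=> _ _; rewrite integral0 => cv0.
have : \forall n \near \oo, (\int[mu]_x (sqn (f x - fn n x))%:E < eps%:E)%E.
  by apply: (cv0 [set y | (y < eps%:E)%E]); apply: open_ereal_lt'; rewrite lte_fin.
move=> [n _ /(_ n (leqnn n))] /= lt_eps.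
exists (fn n); split; first exact: vfn.
have Lffn : L2 mu (fun x => f x - fn n x) by exact: L2B.
by rewrite -lee_fin -L2_normsqE// L2normsqE ltW.
Qed.

Lemma vanishing_parseval f : vanishing f ->
  L2normsq mu f = (\esum_(i in [set: nat]) (sqn (inner mu f (gram_seq i)))%:E)%E.
Proof.
move=> [Lf vf]; rewrite -nneseries_esumT; last by move=> n; rewrite lee_fin sqn_ge0.
apply/esym/cvg_lim => //; rewrite L2_normsqE//.
under eq_fun do rewrite sumEFin sum_inner_gram//.
apply: cvg_EFin; first exact: nearW.
apply/cvgrPdist_le => eps eps0; have [N hN] := vf _ eps0.
exists N => // n /= Nn; rewrite subKr ger0_norm ?normsq_ge0//.
exact: le_trans (normsq_residual_le Lf Nn) hN.
Qed.

End Kaczmarz.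

(** The constant is chosen before the measure, so that one bound serves all slices at once; this is
    possible because |<e_n, e_k>| <= 1 under every measure of mass one. *)
Lemma gram_seq_bounded {disp} {T : measurableType disp} {R : realType}
    (e : nat -> T -> R[i]) n :
  (forall n, cmeasurable (e n)) -> (forall n x, sqn (e n x) = 1) ->
  exists C, forall mu : {measure set T -> \bar R}, mu setT = 1%E ->
    forall x, sqn (gram_seq mu e n x) <= C.
Proof.
move=> me e1; elim/ltn_ind: n => n IHn.
have [C hC] : exists C, forall mu : {measure set T -> \bar R}, mu setT = 1%E ->
    forall x, sqn (\sum_(k < n) inner mu (e n) (e k) * gram_seq mu e k x) <= C.
  elim: (index_enum _) => [|k s [C hC]].
    by exists 0 => mu _ x; rewrite big_nil sqn0.
  have [C' hC'] := IHn k (ltn_ord k).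
  exists (2 * C' + 2 * C) => mu mu1 x; rewrite big_cons.
  apply: le_trans (sqnD_le _ _) _; apply: lerD; rewrite ler_pM2l ?hC//.
  rewrite sqnM -[leRHS]mul1r ler_pM ?sqn_ge0 ?hC'//.
  exact: inner_unimodular_le1.
exists (2 * 1 + 2 * C) => mu mu1 x; rewrite gram_seqE.
apply: le_trans (sqnD_le _ _) _; apply: lerD; rewrite ler_pM2l ?e1//.
by have := hC mu mu1 x; rewrite /sqn ReN ImN !sqrrN.
Qed.

(** * Exponentials, and density of trigonometric polynomials *)

Section FourierExp.
Context {R : realType}.

Lemma sqn_expi (t : R) : sqn (expi t) = 1.
Proof. by rewrite /sqn /expi /= cos2Dsin2. Qed.

Lemma expiD (s t : R) : expi (s + t) = expi s * expi t.
Proof. by apply: eq_Re_Im; rewrite !ReImE /= ?cosD// sinD addrC mulrC [X in X + _]mulrC. Qed.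

Lemma expi0 : expi (0 : R) = 1.
Proof. by rewrite /expi cos0 sin0. Qed.

Lemma expiN (t : R) : expi (- t) = (expi t)^*.
Proof. by rewrite /expi cosN sinN. Qed.

Lemma fourier_exp0 (x : R) : fourier_exp 0 x = 1.
Proof. by rewrite /fourier_exp mulr0 mul0r expi0. Qed.

Lemma fourier_expS n (x : R) :
  fourier_exp n.+1 x = fourier_exp 1 x * fourier_exp n x.
Proof. by rewrite /fourier_exp -expiD; congr expi; ring. Qed.

Lemma sqn_fourier_exp n (x : R) : sqn (fourier_exp n x) = 1.
Proof. exact: sqn_expi. Qed.

Lemma fourier_expJ n (x : R) : fourier_exp n x * (fourier_exp n x)^* = 1.
Proof. by rewrite mulcJ sqn_fourier_exp. Qed.

Lemma measurable_cosM (c : R) : measurable_fun setT (fun x : R => cos (c * x)).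
Proof.
apply: (measurableT_comp (f := cos)); last exact: mulrl_measurable.
by apply: continuous_measurable_fun; exact: continuous_cos.
Qed.

Lemma measurable_sinM (c : R) : measurable_fun setT (fun x : R => sin (c * x)).
Proof.
apply: (measurableT_comp (f := sin)); last exact: mulrl_measurable.
by apply: continuous_measurable_fun; exact: continuous_sin.
Qed.

Lemma cmeasurable_fourier_exp n : cmeasurable (@fourier_exp R n).
Proof. by split; [exact: measurable_cosM | exact: measurable_sinM]. Qed.

(** Each of the [n] terms of 1 + w + ... + w^(n-1) = (1 - w^n) / (1 - w) is at least w^n. *)
Lemma mul_expr_le1 (w : R) n : 0 <= w <= 1 -> n%:R * w ^+ n * (1 - w) <= 1 - w ^+ n.
Proof.
move=> /andP[w0 w1]; elim: n => [|n IHn]; first by rewrite !mul0r expr0 subrr.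
have wn0 : 0 <= w ^+ n by rewrite exprn_ge0.
have wn1 : w ^+ n.+2 <= 1 by rewrite exprn_ile1.
have h1 : w ^+ n.+1 * (1 - w) <= 1 * (1 - w).
  by rewrite ler_wpM2r ?subr_ge0// exprn_ile1.
have h2 : w * (n%:R * w ^+ n * (1 - w)) <= w * (1 - w ^+ n) by rewrite ler_wpM2l.
rewrite -natr1 (_ : _ * (1 - w) =
  w * (n%:R * w ^+ n * (1 - w)) + w ^+ n.+1 * (1 - w)); last by rewrite exprS; ring.
move: h1 h2; rewrite !exprS; lra.
Qed.

Lemma cvg_mul_expr (z : R) : 0 <= z < 1 -> n%:R * z ^+ n @[n --> \oo] --> 0.
Proof.
(* In z^n = w^n w^n one factor absorbs [n] by [mul_expr_le1] and the other decays geometrically. *)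
move=> /andP[z0 z1]; pose w := Num.sqrt z.
have w0 : 0 <= w by exact: sqrtr_ge0.
have ww : w * w = z by rewrite -expr2 sqr_sqrtr.
have w1 : w < 1.
  by rewrite ltNge; apply/negP => w1; have := ler_pM ler01 ler01 w1 w1; rewrite ww; lra.
have w1' : 0 < 1 - w by rewrite subr_gt0.
apply: (@squeeze_cvgr _ _ _ _ (cst 0) (fun n => (1 - w)^-1 * w ^+ n)).
- apply: nearW => n /=; rewrite mulr_ge0 ?exprn_ge0//=.
  rewrite -ww exprMn mulrA ler_wpM2r ?exprn_ge0// -[leRHS]mul1r ler_pdivlMr//.
  apply: le_trans (mul_expr_le1 _ _) _; first by rewrite w0 ltW.
  by rewrite gerBl exprn_ge0.
- exact: cvg_cst.
- by apply: cvg_geometric; rewrite ger0_norm.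
Qed.

Lemma bernoulli_le (y : R) m : 0 <= y <= 1 -> 1 - m%:R * y <= (1 - y) ^+ m.
Proof.
move=> /andP[y0 y1]; elim: m => [|m IHm]; first by rewrite mul0r subr0 expr0.
have y1' : 0 <= 1 - y by rewrite subr_ge0.
rewrite exprS; apply: le_trans (ler_wpM2l y1' IHm); rewrite -natr1.
rewrite -subr_ge0 (_ : _ - _ = m%:R * (y * y)); last by ring.
by rewrite !mulr_ge0.
Qed.

Lemma bernoulli_ge (y : R) m : 0 <= y <= 1 -> (1 - y) ^+ m * (1 + m%:R * y) <= 1.
Proof.
move=> /andP[y0 y1]; elim: m => [|m IHm]; first by rewrite expr0 mul0r addr0 mulr1.
apply: le_trans IHm; rewrite exprSr -mulrA ler_wpM2l ?exprn_ge0 ?subr_ge0//.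
rewrite -natr1 -subr_ge0.
rewrite (_ : _ - _ = (m%:R + 1) * (y * y)); last by ring.
by rewrite !mulr_ge0// addr_ge0.
Qed.

(** By the two Bernoulli bounds everything depends on the exponent times s^n, which is n (2 s)^n: it
    tends to 0 for s < 1/2 and is at least n for s >= 1/2. The factor n in the exponent decides the
    boundary case s = 1/2. *)
Lemma cvg_step (s : R) : 0 <= s <= 1 ->
  (1 - s ^+ n) ^+ (n * 2 ^ n) @[n --> \oo] --> ((s < 2^-1)%R%:R : R).
Proof.
move=> /andP[s0 s1].
have sn n : 0 <= s ^+ n <= 1 by rewrite exprn_ge0//= exprn_ile1.
have sn' n : 0 <= 1 - s ^+ n <= 1 by have := sn n; lra.
have e n : ((n * 2 ^ n)%N%:R : R) * s ^+ n = n%:R * (2 * s) ^+ n.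
  by rewrite natrM natrX exprMn mulrA.
case: ltP => s2.
- apply: (@squeeze_cvgr _ _ _ _ (fun n => 1 - n%:R * (2 * s) ^+ n) (cst 1)).
  + apply: nearW => n; rewrite -e bernoulli_le//=.
    by rewrite exprn_ile1//; have /andP[] := sn' n.
  + rewrite -[X in _ --> X]subr0; apply: cvgB; first exact: cvg_cst.
    by apply: cvg_mul_expr; lra.
  + exact: cvg_cst.
- apply: (@squeeze_cvgr _ _ _ _ (cst 0) (fun n => n.+1%:R^-1)).
  + apply: nearW => n; rewrite exprn_ge0/=; last by have /andP[] := sn' n.
    rewrite -[leRHS]mul1r ler_pdivlMr//.
    apply: le_trans (bernoulli_ge (n * 2 ^ n) (sn n)).
    rewrite ler_wpM2l//; first by rewrite exprn_ge0//; have /andP[] := sn' n.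
    rewrite e -nat1r lerD2l ler_peMr// exprn_ege1//; lra.
  + exact: cvg_cst.
  + exact: cvg_harmonic.
Qed.

End FourierExp.

(** * Multiplication operators on the subspace of functions with vanishing residual *)

Section Density.
Context {R : realType}.
Variable nu : {measure set R -> \bar R}.
Hypothesis nu1 : nu setT = 1%E.

Local Notation e := (@fourier_exp R).
Local Notation u := (@fourier_exp R 1).
Local Notation vanish := (@vanishing _ _ _ nu e).
Local Notation res := (@residual _ _ _ nu e).

Let me := @cmeasurable_fourier_exp R.
Let e1 := @sqn_fourier_exp R.
Let Le := L2_unimodular nu1 me e1.

Lemma mul_fourierJ (z : R[i]) x : u x * ((u x)^* * z) = z.
Proof. by rewrite mulrA fourier_expJ mul1r. Qed.

Lemma mulJ_fourier (z : R[i]) x : (u x)^* * (u x * z) = z.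
Proof. by rewrite mulrCA mul_fourierJ. Qed.

Lemma L2_fourierM f : L2 nu f -> L2 nu (fun x => u x * f x).
Proof. by move=> Lf; apply: (@L2M_bounded _ _ _ _ _ _ 1) => // x; rewrite e1. Qed.

Lemma L2_fourierJM f : L2 nu f -> L2 nu (fun x => (u x)^* * f x).
Proof.
move=> Lf; apply: (@L2M_bounded _ _ _ _ _ _ 1) => //; first exact: cmeasurableJ.
by move=> x; rewrite sqnJ e1.
Qed.

(* With [U] the multiplication by [u] and [P] the projection onto [e 0], this is
   [U^-1 (1 - P)]; conjugating by [U] turns step [n + 1] of the algorithm into
   step [n]. *)
Definition kshift f (x : R) : R[i] := (u x)^* * (f x - inner nu f (e 0)).

Lemma L2_kshift f : L2 nu f -> L2 nu (kshift f).
Proof.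
move=> Lf; apply: L2_fourierJM; apply: L2B => //.
have := L2Z (inner nu f (e 0)) (Le 0%N).
by under eq_fun do rewrite fourier_exp0 mulr1.
Qed.

Lemma residual_kshift f n x : (u x)^* * res f n.+1 x = res (kshift f) n x.
Proof.
elim: n x => [|n IHn] x; first by rewrite /= fourier_exp0 mulr1.
rewrite [res f n.+2]/= [res (kshift f) n.+1]/= mulrBr IHn; congr (_ - _).
rewrite mulrCA (fourier_expS n) mulJ_fourier; congr (_ * _).
rewrite /inner; congr cintegral; apply/funext => y.
by rewrite -IHn (fourier_expS n) rmorphM mulrCA -!mulrA.
Qed.

Lemma vanishing_kshift f : L2 nu f -> vanish (kshift f) <-> vanish f.
Proof.
move=> Lf.
have E n : normsq nu (res (kshift f) n) = normsq nu (res f n.+1).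
  by apply: eq_normsq => x; rewrite -residual_kshift sqnM sqnJ e1 mul1r.
split=> -[_ v]; split => //.
- by move=> eps /v[n hn]; exists n.+1; rewrite -E.
- exact: L2_kshift.
- move=> eps /v[n hn]; exists n; rewrite E; apply: le_trans hn.
  exact: (normsq_residual_le nu1).
Qed.

Lemma vanishingZ (c : R[i]) f : vanish f -> vanish (fun x => c * f x).
Proof.
move=> vf; have := vanishing_lin nu1 me e1 c vf (vanishing0 nu e).
by under eq_fun do rewrite addr0.
Qed.

Lemma vanishingD f g : vanish f -> vanish g -> vanish (fun x => f x + g x).
Proof.
move=> vf vg; have := vanishing_lin nu1 me e1 1 vf vg.
by under eq_fun do rewrite mul1r.
Qed.

(** The constant is [e 0], which the first step removes entirely. *)
Lemma vanishing1 : vanish (fun _ => 1).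
Proof.
have -> : (fun _ => 1) = e 0 by apply/funext => x; rewrite fourier_exp0.
apply/vanishing_kshift => //.
suff -> : kshift (e 0) = fun _ => 0 by exact: vanishing0.
apply/funext => x; rewrite /kshift inner_self (normsq_unimodular nu1 (e1 0%N)).
by rewrite fourier_exp0 subrr mulr0.
Qed.

Lemma vanishing_ae f g : cmeasurable g -> vanish f ->
  {ae nu, forall x, f x = g x} -> vanish g.
Proof.
move=> mg vf fg; have [Lf _] := vf.
have Z : L2normsq nu (fun x => g x - f x) = 0%E.
  rewrite L2normsqE (ae_eq_integral (cst 0%E)) ?integral0//.
  - by apply: measurable_sqnE; apply: cmeasurableB => //; exact: L2_measurable Lf.
  - by apply: filterS fg => x -> _; rewrite subrr sqn0.
have Lgf : L2 nu (fun x => g x - f x).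
  by split; [apply: cmeasurableB => //; exact: L2_measurable Lf | rewrite Z].
apply: (vanishing_closed nu1) => //.
  by have := L2D Lgf Lf; under eq_fun do rewrite subrK.
by move=> eps eps0; exists f; split => //; rewrite /normsq Z ltW.
Qed.

(** The bound serves to rescale [h] into [0,1] in [multiplier_gt]. *)
Definition multiplier (h : R -> R) :=
  [/\ measurable_fun setT h, exists M, forall x, `|h x| <= M &
      forall f, vanish f -> vanish (fun x => (h x)%:C * f x)].

Lemma multiplier_cst (c : R) : multiplier (fun _ => c).
Proof.
split; [exact: measurable_cst | by exists `|c| |].
by move=> f; exact: vanishingZ.
Qed.

Lemma multiplierD h k : multiplier h -> multiplier k ->
  multiplier (fun x => h x + k x).
Proof.
move=> [mh [M hM] vh] [mk [N kN] vk]; split.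
- exact: measurable_funD.
- by exists (M + N) => x; rewrite (le_trans (ler_normD _ _))// lerD.
- move=> f vf; under eq_fun do rewrite rmorphD mulrDl.
  by apply: vanishingD; [exact: vh | exact: vk].
Qed.

Lemma multiplierM h k : multiplier h -> multiplier k ->
  multiplier (fun x => h x * k x).
Proof.
move=> [mh [M hM] vh] [mk [N kN] vk]; split.
- exact: measurable_funM.
- by exists (M * N) => x; rewrite normrM ler_pM.
- move=> f vf; under eq_fun do rewrite rmorphM -mulrA.
  by apply: vh; exact: vk.
Qed.

Lemma multiplierX h n : multiplier h -> multiplier (fun x => h x ^+ n).
Proof.
move=> mh; elim: n => [|n IHn]; first exact: multiplier_cst.
by under eq_fun do rewrite exprS; exact: multiplierM.
Qed.

Lemma multiplierB h k : multiplier h -> multiplier k ->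
  multiplier (fun x => h x - k x).
Proof.
move=> mh mk; have := multiplierD mh (multiplierM (multiplier_cst (-1)) mk).
by under eq_fun do rewrite mulN1r.
Qed.

Lemma multiplier_lim (hn : nat -> R -> R) h (M : R) :
  (forall n, multiplier (hn n)) -> (forall n x, `|hn n x| <= M) ->
  (forall x, hn n x @[n --> \oo] --> h x) -> multiplier h.
Proof.
move=> mhn hM cv.
have hhM x : `|h x| <= M.
  have c : `|hn n x| @[n --> \oo] --> `|h x| by apply: cvg_norm; exact: cv.
  rewrite -(cvg_lim (@Rhausdorff R) c); apply: limr_le; last exact: nearW.
  by apply/cvg_ex; exists `|h x|.
have mh : measurable_fun setT h.
  by apply: (measurable_fun_cvg (h := hn)) => // n; case: (mhn n).
split => //; first by exists M.
move=> f vf; have [/L2P[mf fi] _] := vf.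
have sM k x : `|k x| <= M -> sqn ((k x)%:C * f x) <= M ^+ 2 * sqn (f x).
  move=> kM; rewrite sqnM sqn_real ler_wpM2r ?sqn_ge0// -real_normK ?num_real//.
  by rewrite lerXn2r ?nnegrE// (le_trans (normr_ge0 (k x)) kM).
apply: (vanishing_dominated nu1 me e1 (fn := fun n x => (hn n x)%:C * f x)
  (G := fun x => M ^+ 2 * sqn (f x))) => //.
- by move=> n; case: (mhn n) => _ _; exact.
- exact: cmeasurableM.
- by under eq_fun do rewrite EFinM; exact: integrableZl.
- by move=> n x; exact: sM.
- by move=> x; exact: sM.
- move=> x; under eq_fun do rewrite -mulrBl -rmorphB sqnM sqn_real.
  rewrite (_ : 0 = (h x - h x) ^+ 2 * sqn (f x)); last by rewrite subrr expr0n mul0r.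
  apply: cvgM; last exact: cvg_cst.
  by apply: (continuous_cvg _ (@exprn_continuous R 2 _)); apply: cvgB => //; exact: cvg_cst.
Qed.

(* [cvg_step] is what makes the indicators of half-lines bounded limits of
   polynomials. *)
Lemma multiplier_half h : multiplier h -> (forall x, 0 <= h x <= 1) ->
  multiplier (fun x => (h x < 2^-1)%R%:R).
Proof.
move=> mh h01.
apply: (multiplier_lim (hn := fun n x => (1 - h x ^+ n) ^+ (n * 2 ^ n)) (M := 1)).
- by move=> n; apply: multiplierX; apply: multiplierB;
    [exact: multiplier_cst | exact: multiplierX].
- move=> n x; have /andP[h0 h1] := h01 x.
  have H0 : 0 <= 1 - h x ^+ n by rewrite subr_ge0 exprn_ile1.
  by rewrite ger0_norm ?exprn_ge0// exprn_ile1// gerBl exprn_ge0.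
- by move=> x; exact: cvg_step.
Qed.

Lemma multiplier_gt h (a : R) : multiplier h ->
  multiplier (\1_[set x | a < h x]).
Proof.
move=> mh; have [_ [M hM] _] := mh.
(* [k] is a decreasing affine image of [h] with [h x > a] iff [k x < 1/2]; as [K] bounds |h - a|,
   its values lie in [0,1]. *)
pose K := `|M| + `|a| + 1.
have K0 : 0 < K by rewrite ltr_wpDl// addr_ge0.
pose k x := 2^-1 - (h x - a) * (2 * K)^-1.
have mk : multiplier k.
  apply: multiplierB; first exact: multiplier_cst.
  apply: multiplierM; last exact: multiplier_cst.
  by apply: multiplierB => //; exact: multiplier_cst.
have k01 x : 0 <= k x <= 1.
  have : `|h x - a| <= K.
    rewrite (le_trans (ler_normB _ _))// /K.
    have := hM x; have := ler_norm M; lra.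
  have K2 : 0 < 2 * K by rewrite mulr_gt0.
  rewrite ler_norml /k => /andP[h1 h2].
  have : (h x - a) * (2 * K)^-1 <= 2^-1 by rewrite ler_pdivrMr//; lra.
  have : - 2^-1 <= (h x - a) * (2 * K)^-1 by rewrite ler_pdivlMr//; lra.
  lra.
have := multiplier_half mk k01; congr multiplier; apply/funext => x.
rewrite indicE; congr (nat_of_bool _)%:R.
rewrite /k -subr_gt0 subKr pmulr_lgt0 ?invr_gt0 ?mulr_gt0// subr_gt0.
by apply/idP/idP; rewrite inE.
Qed.

Hypothesis vJ : vanish (fun x => (u x)^*).

(** Multiplication by the conjugate of [u] differs from [kshift] by a multiple of that conjugate
    itself, which vanishes by [vJ]. *)
Lemma vanishing_fourierJM f : vanish f -> vanish (fun x => (u x)^* * f x).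
Proof.
move=> vf; have [Lf _] := vf.
have vk : vanish (kshift f) by apply/vanishing_kshift.
have := vanishingD vk (vanishingZ (inner nu f (e 0)) vJ).
congr vanishing; apply/funext => x; rewrite /kshift; ring.
Qed.

(** The shift of [u f] is [f] up to a multiple of the conjugate of [u]. *)
Lemma vanishing_fourierM f : vanish f -> vanish (fun x => u x * f x).
Proof.
move=> vf; have [Lf _] := vf.
apply/vanishing_kshift; first exact: L2_fourierM.
have := vanishingD vf
  (vanishingZ (- inner nu (fun x => u x * f x) (e 0)) vJ).
congr vanishing; apply/funext => x.
by rewrite /kshift mulrBr mulJ_fourier mulNr [X in _ - X]mulrC.
Qed.

Lemma multiplier_cos : multiplier (fun x => cos (2 * pi * x)).
Proof.
split; first exact: measurable_cosM.
  by exists 1 => x; exact: cos_max.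
move=> f vf.
have := vanishingZ (2^-1)%:C (vanishingD (vanishing_fourierM vf) (vanishing_fourierJM vf)).
congr vanishing; apply/funext => x; rewrite -mulrDl mulrA; congr (_ * _).
by apply: eq_Re_Im; rewrite !ReImE /= mulr1; lra.
Qed.

Lemma multiplier_sin : multiplier (fun x => sin (2 * pi * x)).
Proof.
split; first exact: measurable_sinM.
  by exists 1 => x; exact: sin_max.
move=> f vf.
have := vanishingZ (0 +i* - 2^-1)
  (vanishingD (vanishing_fourierM vf) (vanishingZ (-1) (vanishing_fourierJM vf))).
congr vanishing; apply/funext => x; rewrite mulN1r -mulrBl mulrA; congr (_ * _).
by apply: eq_Re_Im; rewrite !ReImE /= mulr1; lra.
Qed.

Hypothesis nuI : nu Ico01 = 1%E.

Lemma measurable_Ico01 : measurable (@Ico01 R).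
Proof.
rewrite (_ : Ico01 = `[0, 1[%classic); first exact: measurable_itv.
by apply/seteqP; split => x; rewrite /Ico01 /= in_itv.
Qed.

Lemma ae_Ico01 : {ae nu, forall x, Ico01 x}.
Proof.
exists (~` Ico01); split => //.
  by apply: measurableC; exact: measurable_Ico01.
rewrite -setTD measureD ?setTI//; last 2 first.
- exact: measurable_Ico01.
- by rewrite [X in (X < _)%E]nu1 ltry.
by rewrite [X in (X - _)%E]nu1 [X in (_ - X)%E]nuI subee.
Qed.

(** Half-lines are not periodic, but on [0,1), where the measure sits, they agree with sets
    described by sine and cosine. *)
Lemma multiplier_ae (A B : set R) : measurable B -> multiplier (\1_A) ->
  (forall x, Ico01 x -> A x <-> B x) -> multiplier (\1_B).
Proof.
move=> mB [_ _ vA] AB; have mB' := measurable_indic (D := setT) mB.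
split => //.
  by exists 1 => x; rewrite indicE ger0_norm ?ler0n// lern1 leq_b1.
move=> f vf; have [Lf _] := vf; apply: vanishing_ae (vA _ vf) _.
  apply: cmeasurableM; last exact: L2_measurable Lf.
  by split; [exact: mB' | exact: measurable_cst].
apply: filterS ae_Ico01 => x Ix; congr (_%:C * _).
by rewrite !indicE; congr (nat_of_bool _)%:R; apply/idP/idP; rewrite !inE; apply AB.
Qed.

Lemma multiplier_setC A : multiplier (\1_A) -> multiplier (\1_(~` A)).
Proof.
move=> mA; have := multiplierB (multiplier_cst 1) mA.
congr multiplier; apply/funext => x.
by rewrite !indicE in_setC; case: (_ \in _); rewrite /= ?subrr ?subr0.
Qed.

Lemma multiplier_setI A B : multiplier (\1_A) -> multiplier (\1_B) ->
  multiplier (\1_(A `&` B)).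
Proof. by move=> mA mB; rewrite indicI; exact: multiplierM. Qed.

Lemma sin_lt0 (x : R) : 2^-1 < x < 1 -> sin (2 * pi * x) < 0.
Proof.
move=> /andP[x2 x1]; have pi0 := pi_gt0 R.
have -> : 2 * pi * x = (2 * pi * x - pi) + pi by rewrite subrK.
rewrite sinDpi oppr_lt0 sin_gt0_pi//; nra.
Qed.

Lemma cos_sym (x : R) : cos (2 * pi * x) = cos (2 * pi * (1 - x)).
Proof.
rewrite -[in RHS]cosN -[RHS]cosD2pi; congr cos; rewrite -mulr_natl; ring.
Qed.

Lemma ltr_cos2pi (x y : R) : 0 <= x <= 2^-1 -> 0 <= y <= 2^-1 ->
  (cos (2 * pi * x) < cos (2 * pi * y)) = (y < x).
Proof.
move=> /andP[x0 x1] /andP[y0 y1]; have pi0 := pi_gt0 R.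
rewrite ltr_cos ?in_itv/=; [|nra..].
by rewrite ltr_pM2l// mulr_gt0.
Qed.

(** The cosine is injective only on each half of [0,1), and sin < 0 singles out the open second
    half. For 0 <= a < 1/2, x > a means sin < 0 or cos(2 pi x) < cos(2 pi a); for 1/2 <= a < 1 it
    means sin < 0 and cos(2 pi x) > cos(2 pi a). *)
Lemma multiplier_ray (a : R) : multiplier (\1_[set x | a < x]).
Proof.
have mray : measurable [set x : R | a < x].
  rewrite (_ : [set x | a < x] = `]a, +oo[%classic); first exact: measurable_itv.
  by apply/seteqP; split => x; rewrite /= in_itv/= andbT.
have mT : multiplier (\1_[set: R]) by rewrite indicT; exact: multiplier_cst.
have [a0|a0] := ltP a 0.
  by apply: multiplier_ae mT _ => // x /andP[x0 _]; split => //= _; exact: lt_le_trans x0.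
have [a1|a1] := leP 1 a.
  apply: multiplier_ae (multiplier_setC mT) _ => // x /andP[_ x1].
  split => [[]//|/= ax]; have := lt_trans ax x1; rewrite ltNge a1//.
have pi0 := pi_gt0 R.
have mc := multiplier_cos; have ms := multiplier_sin.
have msN : multiplier (\1_[set x | 0 < - sin (2 * pi * x)]).
  apply: multiplier_gt; have := multiplierM (multiplier_cst (-1)) ms.
  by under eq_fun do rewrite mulN1r.
have mcN b : multiplier (\1_[set x | - b < - cos (2 * pi * x)]).
  apply: multiplier_gt; have := multiplierM (multiplier_cst (-1)) mc.
  by under eq_fun do rewrite mulN1r.
have snn (x : R) : 0 <= x <= 2^-1 -> 0 <= sin (2 * pi * x).
  by move=> xx; apply: sin_ge0_pi; nra.
have [a2|a2] := ltP a 2^-1.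
  (* The union of the two conditions, by De Morgan. *)
  have := multiplier_setC (multiplier_setI (multiplier_setC msN)
    (multiplier_setC (mcN (cos (2 * pi * a))))).
  move=> /multiplier_ae; apply => // x /andP[x0 x1] /=.
  rewrite not_andE !notK oppr_gt0 ltrN2; split.
  - case=> [sx|cx]; rewrite ltNge; apply/negP => xa.
      have x2 : x <= 2^-1 by lra.
      by have := snn x; rewrite x0 x2 => /(_ isT); rewrite leNgt sx.
    by move: cx; rewrite ltr_cos2pi; lra.
  - move=> ax; have [sx|sx] := ltP (sin (2 * pi * x)) 0; [by left|right].
    have x2 : x <= 2^-1.
      rewrite leNgt; apply/negP => x2.
      by have := @sin_lt0 x; rewrite x2 x1 => /(_ isT); rewrite ltNge sx.
    by rewrite ltr_cos2pi//; lra.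
have := multiplier_setI msN (multiplier_gt (cos (2 * pi * a)) mc).
move=> /multiplier_ae; apply => // x /andP[x0 x1] /=.
rewrite oppr_gt0; split.
- move=> [sx]; have x2 : 2^-1 < x.
    rewrite ltNge; apply/negP => x2.
    by have := snn x; rewrite x0 x2 => /(_ isT); rewrite leNgt sx.
  rewrite cos_sym (cos_sym x) ltr_cos2pi; lra.
- move=> ax; split; first by apply: sin_lt0; lra.
  by rewrite cos_sym (cos_sym x) ltr_cos2pi; lra.
Qed.

Lemma multiplier_bigcup (F : nat -> set R) :
  (forall n, multiplier (\1_(F n))) -> multiplier (\1_(\bigcup_n F n)).
Proof.
move=> mF.
(* The indicator of the complement of the first [n] sets, as a product, so that the algebra of
   multipliers applies. *)
pose p n x := \prod_(i < n) (1 - \1_(F i) x) : R.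
have p01 n x : p n x = (x \notin \big[setU/set0]_(i < n) F i)%:R.
  elim: n => [|n IHn]; first by rewrite /p !big_ord0 in_set0.
  rewrite /p !big_ord_recr /= -/(p n x) IHn in_setU negb_or indicE.
  by do 2 case: (_ \in _); rewrite /= ?subr0 ?subrr ?mulr1 ?mulr0.
apply: (multiplier_lim (hn := fun n x => 1 - p n x) (M := 1)).
- move=> n; apply: multiplierB; first exact: multiplier_cst.
  elim: n => [|n IHn].
    rewrite (_ : p 0%N = fun _ => 1); first exact: multiplier_cst.
    by apply/funext => x; rewrite /p big_ord0.
  rewrite (_ : p n.+1 = fun x => p n x * (1 - \1_(F n) x)).
    by apply: multiplierM => //; apply: multiplierB => //; exact: multiplier_cst.
  by apply/funext => x; rewrite /p big_ord_recr.
- by move=> n x; rewrite p01; case: (_ \notin _); rewrite /= ?subrr ?subr0 ?normr0 ?normr1.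
- move=> x; rewrite indicE; have [|xF] := boolP (x \in \bigcup_n F n).
    rewrite inE => -[n _ Fnx]; apply: cvg_near_cst; exists n.+1 => // m /= nm.
    rewrite p01 (_ : x \notin _ = false) ?subr0//; apply/negbTE; rewrite negbK inE.
    by rewrite -bigcup_mkord; exists n.
  apply: cvg_near_cst; apply: nearW => m; rewrite p01.
  rewrite (_ : x \notin _ = true) ?subrr//; apply: contra xF; rewrite !inE.
  by rewrite -bigcup_mkord => -[k _ Fk]; exists k.
Qed.

(** The sets whose indicator is a multiplier form a sigma-algebra, and it contains the
    half-lines. *)
Lemma multiplier_indic (A : set R) : measurable A -> multiplier (\1_A).
Proof.
move=> mA; suff : sigma_algebra setT [set A : set R | multiplier (\1_A)].
  have mA' : (@RGenOInfty.G R).-sigma.-measurable A by rewrite -RGenOInfty.measurableE.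
  move=> sa; apply: (smallest_sub sa _ mA') => B [x ->] /=.
  rewrite (_ : `]x, +oo[%classic = [set y | x < y]); first exact: multiplier_ray.
  by apply/seteqP; split => y; rewrite /= in_itv/= andbT.
split.
- by rewrite /= indic0; exact: multiplier_cst.
- by move=> B mB; rewrite setTD; exact: multiplier_setC.
- by move=> F mF; exact: multiplier_bigcup.
Qed.

Import HBNNSimple.

Lemma vanishing_ge0 (g : R -> R) : measurable_fun setT g ->
  (forall x, 0 <= g x) -> nu.-integrable setT (fun x => (g x ^+ 2)%:E) ->
  vanish (fun x => (g x)%:C).
Proof.
move=> mg g0 ig; have mgE : measurable_fun setT (EFin \o g) by exact/measurable_EFinP.
pose s := nnsfun_approx measurableT mgE.
have scv x : s n x @[n --> \oo] --> g x.
  have : EFin \o s^~ x @ \oo --> (EFin \o g) x.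
    by apply: cvg_nnsfun_approx => // y _; rewrite lee_fin.
  exact: fine_cvg.
have sg n x : s n x <= g x.
  rewrite -(cvg_lim (@Rhausdorff R) (scv x)).
  apply: (@nondecreasing_cvgn_le _ (s^~ x)); last by apply/cvg_ex; exists (g x).
  by move=> i j ij; have /lefP := nd_nnsfun_approx measurableT mgE ij; exact.
apply: (vanishing_dominated nu1 me e1 (fn := fun n x => (s n x)%:C) (G := fun x => g x ^+ 2)) => //.
- move=> n; under eq_fun do rewrite fimfunEord rmorph_sum.
  elim: (index_enum _) => [|i r IHr].
    by under eq_fun do rewrite big_nil; exact: vanishing0.
  under eq_fun do rewrite big_cons; apply: vanishingD => //.
  under eq_fun do rewrite rmorphM; apply: vanishingZ.
  (* The indicator is obtained by letting the multiplier act on the constant 1. *)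
  set A := (X in \1_X); have mA : measurable A by exact: measurable_funPTI.
  have [_ _ /(_ _ vanishing1)] := multiplier_indic mA.
  by under eq_fun do rewrite mulr1.
- by move=> n x; rewrite sqn_real lerXn2r ?nnegrE.
- by move=> x; rewrite sqn_real.
- move=> x; under eq_fun do rewrite -rmorphB sqn_real.
  rewrite (_ : 0 = (g x - g x) ^+ 2); last by rewrite subrr expr0n.
  by apply: (continuous_cvg _ (@exprn_continuous R 2 _)); apply: cvgB => //; exact: cvg_cst.
Qed.

Lemma vanishing_real (g : R -> R) : measurable_fun setT g ->
  nu.-integrable setT (fun x => (g x ^+ 2)%:E) ->
  vanish (fun x => (g x)%:C).
Proof.
move=> mg ig.
have half (h : R -> R) : measurable_fun setT h -> (forall x, 0 <= h x) -> (forall x, h x <= `|g x|) ->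
    vanish (fun x => (h x)%:C).
  move=> mh h0 hg; apply: vanishing_ge0 => //.
  apply: (le_integrable measurableT _ _ ig).
    by apply/measurable_EFinP; exact: measurable_funX.
  move=> x _; rewrite !gee0_abs ?lee_fin ?sqr_ge0// -[leRHS]real_normK ?num_real//.
  by rewrite lerXn2r ?nnegrE.
have := vanishingD (half (fun x => (`|g x| + g x) / 2) _ _ _)
  (vanishingZ (-1) (half (fun x => (`|g x| - g x) / 2) _ _ _)).
have mn : measurable_fun setT (fun x => `|g x|) by exact: measurableT_comp.
have gg x : - `|g x| <= g x <= `|g x| by rewrite -ler_norml.
move=> H; have : vanish (fun x => ((`|g x| + g x) / 2)%:C + -1 * ((`|g x| - g x) / 2)%:C).
  apply: H.
  - by apply: measurable_funM; [exact: measurable_funD | exact: measurable_cst].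
  - move=> x; have := gg x; lra.
  - move=> x; have := gg x; lra.
  - by apply: measurable_funM; [exact: measurable_funB | exact: measurable_cst].
  - move=> x; have := gg x; lra.
  - move=> x; have := gg x; lra.
congr vanishing; apply/funext => x; apply: eq_Re_Im; rewrite !ReImE /=; lra.
Qed.

Lemma vanishing_L2 f : L2 nu f -> vanish f.
Proof.
move=> /L2P[[m1 m2] fi].
have v1 : vanish (fun x => (complex.Re (f x))%:C).
  apply: vanishing_real => //; apply: (le_integrable measurableT _ _ fi).
    by apply/measurable_EFinP; exact: measurable_funX.
  by move=> x _; rewrite !gee0_abs ?lee_fin ?sqn_ge0 ?sqr_ge0// lerDl sqr_ge0.
have v2 : vanish (fun x => (complex.Im (f x))%:C).
  apply: vanishing_real => //; apply: (le_integrable measurableT _ _ fi).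
    by apply/measurable_EFinP; exact: measurable_funX.
  by move=> x _; rewrite !gee0_abs ?lee_fin ?sqn_ge0 ?sqr_ge0// lerDr sqr_ge0.
have := vanishingD v1 (vanishingZ (0 +i* 1) v2).
congr vanishing; apply/funext => x; case: (f x) => a b.
by apply: eq_Re_Im; rewrite !ReImE /=; ring.
Qed.

End Density.

(** * Cauchy and Poisson integrals *)

Section CauchyKernel.
Context {R : realType}.
Implicit Types (z w : R[i]) (r : R).

Local Notation e := (@fourier_exp R).
Local Notation u := (@fourier_exp R 1).

Lemma ReV z : complex.Re z^-1 = complex.Re z / sqn z.
Proof. by case: z. Qed.

Lemma ImV z : complex.Im z^-1 = - (complex.Im z / sqn z).
Proof. by case: z. Qed.

Lemma sqnV z : sqn z^-1 = (sqn z)^-1.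
Proof.
have [->|z0] := eqVneq z 0; first by rewrite invr0 sqn0 invr0.
have s0 : sqn z != 0 by apply: contra z0 => /eqP/sqn_eq0 ->.
by rewrite [LHS]/sqn ReV ImV sqrrN !expr_div_n -mulrDl -/(sqn z) expr2 invfM mulrA divff// mul1r.
Qed.

Lemma sqnX z n : sqn (z ^+ n) = sqn z ^+ n.
Proof.
elim: n => [|n IHn]; last by rewrite !exprS sqnM IHn.
by rewrite !expr0 /sqn /= expr0n addr0 expr1n.
Qed.

Lemma sqn_oneB w : sqn (1 - w) = 1 - 2 * complex.Re w + sqn w.
Proof. by rewrite /sqn !ReImE /=; ring. Qed.

Lemma Re_le_sqn z (c : R) : 0 <= c -> sqn z <= c ^+ 2 -> `|complex.Re z| <= c.
Proof.
move=> c0 zc; rewrite -(ler_pXn2r (n := 2))// ?nnegrE// real_normK ?num_real//.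
by apply: le_trans zc; rewrite lerDl sqr_ge0.
Qed.

Lemma sqn_oneB_ge w r : 0 <= r -> sqn w = r ^+ 2 -> (1 - r) ^+ 2 <= sqn (1 - w).
Proof.
move=> r0 wr; have := @Re_le_sqn w r r0; rewrite wr lexx => /(_ isT).
by rewrite ler_norml sqn_oneB wr => /andP[_ ?]; nra.
Qed.

Lemma oneB_neq0 w r : 0 <= r < 1 -> sqn w = r ^+ 2 -> 1 - w != 0.
Proof.
move=> /andP[r0 r1] wr; apply/eqP => w1; have := sqn_oneB_ge r0 wr.
by rewrite w1 sqn0 leNgt exprn_gt0// subr_gt0.
Qed.

(* The right-hand side is the Poisson kernel of radius [r]. *)
Lemma Re_oneBV w r : 0 <= r < 1 -> sqn w = r ^+ 2 ->
  2 * complex.Re (1 - w)^-1 - 1 = (1 - r ^+ 2) / sqn (1 - w).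
Proof.
move=> r01 wr; have /andP[r0 r1] := r01; rewrite ReV.
have s0 : sqn (1 - w) != 0.
  by rewrite gt_eqF// (lt_le_trans _ (sqn_oneB_ge r0 wr))// exprn_gt0// subr_gt0.
apply: (mulIf s0); rewrite mulrBl mulrA !divfK// mul1r sqn_oneB wr !ReImE /=.
ring.
Qed.

Lemma oneBV_rec w r : 0 <= r < 1 -> sqn w = r ^+ 2 ->
  (1 - w)^-1 = 1 + w * (1 - w)^-1.
Proof.
move=> r01 wr; have w0 := oneB_neq0 r01 wr.
by apply: (mulIf w0); rewrite mulrDl mulVf// -mulrA mulVf// mul1r mulr1 subrK.
Qed.

Lemma sqn_oneBV_le w r : 0 <= r < 1 -> sqn w = r ^+ 2 ->
  sqn (1 - w)^-1 <= (1 - r) ^- 2.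
Proof.
move=> /andP[r0 r1] wr; have h : 0 < (1 - r) ^+ 2 by rewrite exprn_gt0// subr_gt0.
rewrite sqnV lef_pV2 ?posrE//; first exact: sqn_oneB_ge.
exact: lt_le_trans (sqn_oneB_ge r0 wr).
Qed.

Lemma cmeasurableV {d} {T : measurableType d} (f : T -> R[i]) :
  cmeasurable f -> (forall x, sqn (f x) != 0) -> cmeasurable (fun x => (f x)^-1).
Proof.
move=> mf f0; have [m1 m2] := mf.
have mV : measurable_fun setT (fun x => (sqn (f x))^-1).
  have -> : (fun x => (sqn (f x))^-1) = (fun x => sqn (f x) `^ (-1)).
    by apply/funext => x; rewrite powR_inv1// sqn_ge0.
  apply: (measurableT_comp (f := fun y : R => y `^ (-1))); last exact: measurable_sqn.
  exact: measurable_powR.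
split.
- by under eq_fun do rewrite ReV; exact: measurable_funM.
- by under eq_fun do rewrite ImV; apply: measurable_funN; exact: measurable_funM.
Qed.

Variable b : nat -> R[i].

(** For the coefficients [b] of e_(-1) this is [u] times the n-th residual of e_(-1), see
    [ppoly_residual]. An arbitrary [b] is allowed so that [apoly_kernel] is pure algebra. *)
Fixpoint ppoly (n : nat) (x : R) : R[i] :=
  if n is m.+1 then ppoly m x - b m * e m.+1 x else 1.

(** The Taylor polynomial of degree [n] of 1 - b(z), where b(z) is the sum of b_k z^(k+1). *)
Definition apoly (n : nat) z : R[i] := 1 - \sum_(k < n) b k * z ^+ k.+1.

(* [conjc] is spelled out because [^*] means [Num.conj] in the body of a sum. *)
Lemma apoly_kernel N z x q : q = 1 + z * (u x)^* * q ->
  apoly N z * q = \sum_(0 <= n < N.+1) z ^+ n * (ppoly n x * conjc (e n x)) +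
                  (z * (u x)^*) ^+ N.+1 * (ppoly N x * q).
Proof.
move=> hq.
have eX n : conjc (e n x) = conjc (u x) ^+ n.
  elim: n => [|n IHn]; first by rewrite fourier_exp0 rmorph1 expr0.
  by rewrite (fourier_expS n) conjcM exprS; congr (_ * _).
have eJ n : e n x * (e n x)^* = 1 by exact: fourier_expJ.
elim: N => [|N IHN].
  rewrite big_nat1 /apoly big_ord0 [ppoly 0 x]/= fourier_exp0 rmorph1 subr0.
  by rewrite expr0 expr1 !mul1r.
rewrite big_nat_recr// [ppoly N.+1 x]/=.
rewrite (_ : apoly N.+1 z = apoly N z - b N * z ^+ N.+1); last first.
  by rewrite /apoly big_ord_recr /= opprD addrA.
rewrite mulrBl IHN -addrA -[in RHS]addrA; congr (_ + _).
set p := ppoly N x; set c := b N.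
rewrite [in X in _ = X + _]eX exprMn -(eX N.+1).
set E := (e N.+1 x)^*; set Z := z ^+ N.+1.
have EE : e N.+1 x * E = 1 by exact: eJ.
rewrite [in RHS]exprSr exprMn -(eX N.+1) -/E -/Z.
set F := e N.+1 x in EE *.
(* Replacing [ppoly N] by [ppoly N.+1] in the remainder costs b_N z^(N+1) q, because [e N.+1] is
   unimodular; passing from [apoly N] to [apoly N.+1] subtracts exactly this. One step [hq] of the
   geometric series then splits off the new term of the sum. *)
have -> : Z * E * (p * q) = Z * E * ((p - c * F) * q) + c * Z * q * (F * E) by ring.
rewrite EE mulr1 addrK [in LHS]hq; ring.
Qed.

End CauchyKernel.

(** * The Cauchy transform of a measure and the truncated identity (1 - b) Phi = 1 *)

Section CauchyTransform.
Context {R : realType}.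
Variable nu : {measure set R -> \bar R}.
Hypothesis nu1 : nu setT = 1%E.

Local Notation e := (@fourier_exp R).
Local Notation u := (@fourier_exp R 1).
Local Notation res := (@residual _ _ _ nu e).

Let me := @cmeasurable_fourier_exp R.
Let e1 := @sqn_fourier_exp R.
Let Le := L2_unimodular nu1 me e1.
Let ubar (x : R) := (u x)^*.
Let b k := inner nu (res ubar k) (e k).

Lemma L2_ubar : L2 nu ubar.
Proof.
apply: (@L2_bounded _ _ _ nu nu1 _ 1); first exact: cmeasurableJ.
by move=> x; rewrite sqnJ e1.
Qed.

Lemma ppoly_residual n x : ppoly b n x = u x * res ubar n x.
Proof.
elim: n => [|n IHn]; first by rewrite /= fourier_expJ.
rewrite [ppoly _ _ _]/= IHn [res ubar n.+1]/= mulrBr (fourier_expS n).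
by rewrite (mulrCA (u x)).
Qed.

Lemma L2_ppoly n : L2 nu (ppoly b n).
Proof.
rewrite (_ : ppoly b n = fun x => u x * res ubar n x); last first.
  by apply/funext => x; exact: ppoly_residual.
by apply: L2_fourierM; apply: L2_residual => //; exact: L2_ubar.
Qed.

Lemma normsq_ppoly n : normsq nu (ppoly b n) = normsq nu (res ubar n).
Proof. by apply: eq_normsq => x; rewrite ppoly_residual sqnM e1 mul1r. Qed.

Lemma normsq_ppolyE n : normsq nu (ppoly b n) = 1 - \sum_(k < n) sqn (b k).
Proof.
rewrite normsq_ppoly; elim: n => [|n IHn].
  rewrite big_ord0 subr0 /= (normsq_unimodular nu1)// => x.
  by rewrite sqnJ e1.
rewrite (normsq_residualS nu1 me e1)//; last exact: L2_ubar.
by rewrite IHn big_ord_recr /= -/(b n); ring.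
Qed.

Lemma normsq_ppoly_le1 n : normsq nu (ppoly b n) <= 1.
Proof. by rewrite normsq_ppolyE gerBl sumr_ge0// => k _; exact: sqn_ge0. Qed.

(** For n > 0 a common factor [u] cancels, and what remains is that the residual after a step is
    orthogonal to the exponential just projected out. *)
Lemma inner_ppoly n : inner nu (ppoly b n) (e n) = (n == 0%N)%:R.
Proof.
case: n => [|n].
  rewrite /inner -[RHS](cintegral_cst nu1); congr cintegral; apply/funext => x.
  by rewrite fourier_exp0 rmorph1 mulr1.
rewrite -[RHS](inner_residualS nu1 me e1 n L2_ubar) /inner; congr cintegral.
apply/funext => x; rewrite ppoly_residual (fourier_expS n) rmorphM.
have vc : u x * Num.conj (u x) = 1 := fourier_expJ 1 x.
by rewrite mulrACA vc mul1r.
Qed.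

Variables (r : R) (z : R[i]).
Hypothesis r01 : 0 <= r < 1.
Hypothesis zr : sqn z = r ^+ 2.

Local Notation q := (fun x => (1 - z * (u x)^*)^-1).
Definition cauchy_transform : R[i] := cintegral nu q.

Let wr x : sqn (z * (u x)^*) = r ^+ 2.
Proof. by rewrite sqnM sqnJ e1 mulr1. Qed.

Let q_bound x : sqn (q x) <= (1 - r) ^- 2.
Proof. exact: sqn_oneBV_le. Qed.

Lemma cmeasurable_oneBZ : cmeasurable (fun x => 1 - z * (u x)^*).
Proof.
apply: cmeasurableB; first exact: cmeasurable_cst.
by apply: cmeasurableM; [exact: cmeasurable_cst | exact: cmeasurableJ].
Qed.

Lemma cmeasurable_cauchy : cmeasurable q.
Proof.
apply: cmeasurableV; first exact: cmeasurable_oneBZ.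
move=> x; apply/eqP => /sqn_eq0 h; have := oneB_neq0 r01 (wr x).
by rewrite h eqxx.
Qed.

Lemma L2_cauchy : L2 nu q.
Proof. exact: (L2_bounded nu1 cmeasurable_cauchy q_bound). Qed.

Lemma L2_integrable f : L2 nu f -> cintegrable nu f.
Proof.
move=> Lf; have := L2_inner_integrable Lf (Le 0%N).
by under [X in cintegrable _ X]eq_fun do rewrite fourier_exp0 rmorph1 mulr1.
Qed.

Lemma Re_cauchy_transform : 2 * complex.Re cauchy_transform - 1 =
  \int[nu]_x ((1 - r ^+ 2) / sqn (1 - z * (u x)^*)).
Proof.
have [i1 _] := L2_integrable L2_cauchy.
under [in RHS]eq_Rintegral do rewrite -Re_oneBV//.
rewrite RintegralB//; [|exact: integrableZlE|exact: (integrable_cst1 nu1)].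
by rewrite RintegralZl// Rintegral_cst// mul1r nu1.
Qed.

Definition cauchy_error N : R[i] :=
  cintegral nu (fun x => (z * (u x)^*) ^+ N.+1 * (ppoly b N x * q x)).

Let mbx N : L2 nu (fun x => (z * (u x)^*) ^+ N.+1 * (ppoly b N x * q x)).
Proof.
suff : L2 nu (fun x => ((z * (u x)^*) ^+ N.+1 * q x) * ppoly b N x).
  by congr L2; apply/funext => x; rewrite mulrAC mulrA.
apply: (@L2M_bounded _ _ _ _ _ _ ((r ^+ 2) ^+ N.+1 * (1 - r) ^- 2)).
- exact: L2_ppoly.
- apply: cmeasurableM; last exact: cmeasurable_cauchy.
  elim: N.+1 => [|n IHn]; first by under eq_fun do rewrite expr0; exact: cmeasurable_cst.
  under eq_fun do rewrite exprS; apply: cmeasurableM => //.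
  by apply: cmeasurableM; [exact: cmeasurable_cst | exact: cmeasurableJ].
- by move=> x; rewrite sqnM sqnX wr ler_wpM2l// !exprn_ge0//; case/andP: r01.
Qed.

(** Integrating [apoly_kernel], every term of the sum except the one of index 0 vanishes by
    [inner_ppoly]. *)
Lemma apoly_cauchy N : apoly b N z * cauchy_transform = 1 + cauchy_error N.
Proof.
have Li n : cintegrable nu (fun x => z ^+ n * (ppoly b n x * (e n x)^*)).
  by apply: cintegrableZ; exact: L2_inner_integrable (L2_ppoly n) (Le n).
rewrite /cauchy_transform -cintegralZ; last exact: L2_integrable L2_cauchy.
under [X in cintegral _ X]eq_fun do rewrite (apoly_kernel b N (oneBV_rec r01 (wr _))).
rewrite cintegralD; [|exact: cintegrable_sum|exact: L2_integrable].
congr (_ + _); rewrite cintegral_sum// big_nat_recl// big1 => [|n _].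
  rewrite addr0 cintegralZ ?expr0 ?mul1r; last exact: L2_inner_integrable (L2_ppoly 0) (Le 0).
  exact: (inner_ppoly 0).
rewrite cintegralZ; last exact: L2_inner_integrable (L2_ppoly _) (Le _).
by rewrite [X in _ * X](inner_ppoly n.+1) mulr0.
Qed.

(** The power contributes r^(N+1), the kernel [q] at most 1 / (1 - r), and [ppoly b N] has norm at
    most 1. *)
Lemma sqn_cauchy_error N : sqn (cauchy_error N) <= (r ^+ N.+1 / (1 - r)) ^+ 2.
Proof.
apply: le_trans (sqn_cintegral_le nu1 (mbx N)) _.
have Lc : L2 nu (fun x => (r ^+ N.+1 / (1 - r))%:C * ppoly b N x).
  exact: L2Z (L2_ppoly N).
apply: (@le_trans _ _ (normsq nu (fun x => (r ^+ N.+1 / (1 - r))%:C * ppoly b N x))).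
  apply: le_normsq => // x; rewrite !sqnM sqnX wr sqn_real mulrCA [leRHS]mulrC.
  rewrite ler_wpM2l ?sqn_ge0// [leRHS]exprMn exprVn -!exprM mulnC.
  by have /andP[r0 _] := r01; rewrite ler_wpM2l ?exprn_ge0 ?q_bound.
rewrite normsqZ; last exact: L2_ppoly.
by rewrite sqn_real -[leRHS]mulr1 ler_wpM2l ?sqr_ge0// normsq_ppoly_le1.
Qed.

(* Expand [1 - |1 - A|^2 = 2 Re A - |A|^2], multiplied by [|Phi|^2 >= 1/4]. *)
Lemma apoly_bound (A Phi E : R[i]) (P d : R) : 0 < d ->
  A * Phi = 1 + E -> 2 * complex.Re Phi - 1 = P -> 0 <= P -> sqn E <= d ^+ 2 ->
  1 - sqn (1 - A) <= 4 * P + 13 * d.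
Proof.
move=> d0 hA hP P0 hE; have d0' := ltW d0.
pose L := 1 - sqn (1 - A); rewrite -/L.
have LE : L * sqn Phi =
    2 * complex.Re ((1 + E) * Phi^*) - sqn (1 + E).
  rewrite -hA -mulrA mulcJ sqnM /L sqn_oneB ReM /=; ring.
have s0 := sqn_ge0 Phi.
(* As [P] is nonnegative, the real part of [Phi] is at least 1/2. *)
have s4 : 1 / 4 <= sqn Phi.
  have : complex.Re Phi ^+ 2 <= sqn Phi by rewrite lerDl sqr_ge0.
  nra.
have rE : - complex.Re E <= d.
  by have := Re_le_sqn d0' hE; rewrite ler_norml => /andP[]; lra.
(* Weighted arithmetic-geometric mean: the left side is at most |E|^2 / d + d |Phi|^2, and |E| <=
   d. *)
have mE : 2 * complex.Re (E * Phi^*) <= d + d * sqn Phi.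
  have h : 0 <= sqn (E - d%:C * Phi) by exact: sqn_ge0.
  have : 2 * complex.Re (E * Phi^*) * d <= (d + d * sqn Phi) * d.
    move: h hE; rewrite /sqn !ReImE /=; set a := complex.Re E; set c := complex.Im E.
    set f := complex.Re Phi; set g := complex.Im Phi; lra.
  by rewrite ler_pM2r.
have : L * sqn Phi <= P + 3 * d + d * sqn Phi.
  have -> : L * sqn Phi = 2 * complex.Re Phi - 1
      + 2 * complex.Re (E * Phi^*) - 2 * complex.Re E - sqn E.
    by rewrite LE /sqn !ReImE /=; ring.
  have := sqn_ge0 E; lra.
(* Division by |Phi|^2 >= 1/4 turns P + 3 d into at most 4 P + 12 d, and d |Phi|^2 into d; this is
   the origin of 4 and 13. *)
have := sqn_ge0 Phi; set s := sqn Phi in s4 *.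
nra.
Qed.

Lemma one_sub_sqn_apoly_le N : 0 < r ->
  1 - sqn (1 - apoly b N z) <=
  4 * (\int[nu]_x ((1 - r ^+ 2) / sqn (1 - z * (u x)^*))) + 13 * (r ^+ N.+1 / (1 - r)).
Proof.
move=> r0; have /andP[_ r1] := r01.
apply: apoly_bound (apoly_cauchy N) Re_cauchy_transform _ (sqn_cauchy_error N).
  by rewrite divr_gt0 ?exprn_gt0 ?subr_gt0.
apply: Rintegral_ge0 => x _; rewrite divr_ge0 ?sqn_ge0// subr_ge0.
by rewrite exprn_ile1 ?ltW.
Qed.

End CauchyTransform.

(** * Lebesgue measure on the unit interval as a probability measure *)

Section UniformMeasure.
Context {R : realType}.

Local Notation e := (@fourier_exp R).
Local Notation u := (@fourier_exp R 1).

(* [uniform_prob] lives on [measurableTypeR R], which has the Borel sets of [R]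
   but a different display. *)
Let idR : measurableTypeR R -> R := idfun.

#[local] HB.instance Definition _ :=
  @isMeasurableFun.Build _ _ _ _ idR (@measurable_id _ _ setT).

Definition lam : probability R R :=
  distribution (uniform_prob (@ltr01 R) : probability (measurableTypeR R) R) idR.

Lemma lam1 : lam setT = 1%E.
Proof. exact: probability_setT. Qed.

Lemma integral_lam (f : R -> R) : measurable_fun setT f -> (forall x, 0 <= f x) ->
  (\int[lam]_x (f x)%:E = \int[lebesgue_measure]_(x in `[0%R, 1%R]) (f x)%:E)%E.
Proof.
move=> mf f0; have mfE : measurable_fun setT (EFin \o f) by exact/measurable_EFinP.
rewrite ge0_integral_distribution//.
have := @integral_uniform R 0 1 ltr01 (EFin \o f) mfE; rewrite subr0 invr1 mul1e; apply.
by move=> x; rewrite lee_fin.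
Qed.

Lemma lam_FTC (f F : R -> R) (M : R) : continuous f -> (forall x, `|f x| <= M) ->
  (forall x : R, is_derive x 1 F (f x)) ->
  \int[lam]_x (f x) = F 1 - F 0.
Proof.
(* The shift by [M] makes the integrand nonnegative, as [integral_lam] requires. *)
move=> cf fM dF; pose g x := M + f x.
have mf : measurable_fun setT f by exact: continuous_measurable_fun.
have g0 x : 0 <= g x by have := fM x; rewrite ler_norml /g => /andP[]; lra.
have mg : measurable_fun setT g by apply: measurable_funD => //; exact: measurable_cst.
have dG (x : R) : is_derive x 1 (fun x => M * x + F x) (g x).
  apply: is_deriveD.
  by have := is_deriveZ M (is_derive_id x (1:R)); rewrite /= scaler1.
have dGd (x : R) : derivable (fun x => M * x + F x) x 1 by case: (dG x).
have cG : continuous (fun x => M * x + F x).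
  by move=> x; apply: differentiable_continuous; apply/derivable1_diffP.
have : (\int[lam]_x (g x)%:E = (M + (F 1 - F 0))%:E)%E.
  rewrite integral_lam//.
  rewrite (@continuous_FTC2 _ _ (fun x => M * x + F x))//.
  - by rewrite -EFinB mulr1 mulr0 add0r addrA.
  - by apply: continuous_subspaceT => x; apply: cvgD; [exact: cvg_cst|exact: cf].
  - split => //.
      by apply: cvg_at_right_filter; exact: cG.
    by apply: cvg_at_left_filter; exact: cG.
  - by move=> x _; rewrite derive1E; have [_ ->] := dG x.
move=> /(congr1 fine) /=; rewrite -[LHS]/(\int[lam]_x g x).
have fi : lam.-integrable setT (EFin \o f).
  apply: (le_integrable measurableT _ _ (integrable_cst1 lam1 M)).
    exact/measurable_EFinP.
  by move=> x _ /=; rewrite lee_fin [leRHS]ger0_norm// (le_trans (normr_ge0 _) (fM 0)).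
rewrite RintegralD//; last exact: (integrable_cst1 lam1 M).
by rewrite Rintegral_cst// [X in fine X]lam1 mulr1 => /addrI.
Qed.

Lemma cintegral_lam_exp m : (0 < m)%N -> cintegral lam (e m) = 0.
Proof.
move=> m0; pose c : R := 2 * pi * m%:R.
have c0 : c != 0 by rewrite !mulf_neq0// ?gt_eqF ?pi_gt0// ltr0n.
have dc (x : R) : is_derive x 1 (fun x => c * x) c.
  by have := is_deriveZ c (is_derive_id x (1:R)); rewrite /= scaler1.
have c2 k : cos (2 * pi * k%:R) = 1 :> R /\ sin (2 * pi * k%:R) = 0 :> R.
  elim: k => [|k [IH1 IH2]]; first by rewrite mulr0 cos0 sin0.
  rewrite (_ : 2 * pi * k.+1%:R = 2 * pi * k%:R + pi *+ 2); last first.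
    by rewrite -natr1 -mulr_natl; ring.
  by rewrite cosD2pi sinD2pi.
have [cc sc] := c2 m.
apply: eq_Re_Im => /=.
- pose F x := c^-1 * sin (c * x); transitivity (F 1 - F 0); last first.
    by rewrite /F mulr1 !mulr0 sin0 /c sc mulr0 subrr.
  apply: (@lam_FTC _ F 1).
  + move=> x; apply: continuous_comp; last exact: continuous_cos.
    exact: mulrl_continuous.
  + by move=> x; exact: cos_max.
  + move=> x; have dF := is_deriveZ c^-1 (is_derive1_comp (is_derive_sin (c * x)) (dc x)).
    by apply: is_derive_eq; rewrite /GRing.scale /= mulrCA mulVf// mulr1.
- pose F x := - (c^-1 * cos (c * x)); transitivity (F 1 - F 0); last first.
    by rewrite /F mulr1 !mulr0 cos0 /c cc mulr1 subrr.
  apply: (@lam_FTC _ F 1).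
  + move=> x; apply: continuous_comp; last exact: continuous_sin.
    exact: mulrl_continuous.
  + by move=> x; exact: sin_max.
  + move=> x.
    have dF := is_deriveN (is_deriveZ c^-1 (is_derive1_comp (is_derive_cos (c * x)) (dc x))).
    by apply: is_derive_eq; rewrite /GRing.scale /= mulNr mulrN opprK mulrCA mulVf// mulr1.
Qed.

End UniformMeasure.

(** * Orthogonality of exponentials and estimates of the Poisson kernel *)

Section PoissonIntegral.
Context {R : realType}.

Local Notation e := (@fourier_exp R).
Local Notation u := (@fourier_exp R 1).
Local Notation lam := (@lam R).

Let me := @cmeasurable_fourier_exp R.
Let e1 := @sqn_fourier_exp R.
Let Le := L2_unimodular (@lam1 R) me e1.

Lemma fourier_expD m n (x : R) : e (m + n) x = e m x * e n x.
Proof. by rewrite /fourier_exp -expiD natrD; congr expi; ring. Qed.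

Lemma fourier_exp_pow n (x : R) : e n x = u x ^+ n.
Proof.
elim: n => [|n IHn]; first by rewrite fourier_exp0 expr0.
by rewrite (fourier_expS n) exprS IHn.
Qed.

Lemma inner_lam j k : (j < k)%N -> inner lam (e j) (e k) = 0.
Proof.
move=> jk; have E x : e j x * (e k x)^* = (e (k - j) x)^*.
  rewrite -{1}(subnKC (ltnW jk)) fourier_expD rmorphM mulrA.
  by rewrite fourier_expJ mul1r.
rewrite /inner (_ : (fun x => _) = fun x => (e (k - j) x)^*); last first.
  by apply/funext => x; exact: E.
rewrite cintegralJ; last first.
  by have := L2_inner_integrable (Le (k - j)) (Le 0%N);
    under [X in cintegrable _ X]eq_fun do rewrite fourier_exp0 rmorph1 mulr1.
by rewrite cintegral_lam_exp ?subn_gt0// rmorph0.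
Qed.

Lemma normsq_lam_sum (c : nat -> R[i]) N :
  normsq lam (fun x => \sum_(k < N) c k * e k.+1 x) = \sum_(k < N) sqn (c k).
Proof.
have Lc k : L2 lam (fun x => c k * e k.+1 x) by exact: L2Z.
elim: N => [|N IHN].
  rewrite big_ord0 /normsq L2normsqE.
  by under eq_integral do rewrite big_ord0 sqn0; rewrite integral0.
under [X in normsq _ X]eq_fun do rewrite big_ord_recr /=.
rewrite normsqD//; last exact: L2_sum.
rewrite IHN normsqZ// (normsq_unimodular (@lam1 R) (e1 N.+1)) mulr1 big_ord_recr.
rewrite innerZr//; last exact: L2_sum.
rewrite inner_suml// [X in complex.Re (_ * X)]big1 => [|k _].
  by rewrite !mulr0 addr0.
by rewrite innerZl// inner_lam ?mulr0// ltnS.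
Qed.

Variable r : R.
Hypothesis r01 : 0 <= r < 1.

Lemma sqn_realM_fourier (x : R) : sqn (r%:C * u x) = r ^+ 2.
Proof. by rewrite sqnM e1 mulr1 sqn_real. Qed.

Lemma L2_apoly (b : nat -> R[i]) N : L2 lam (fun x => 1 - apoly b N (r%:C * u x)).
Proof.
have := @L2_sum _ _ _ lam _ (index_enum 'I_N)
  (fun (k : 'I_N) x => (b k * r%:C ^+ k.+1) * e k.+1 x)
  (fun k => L2Z _ (Le k.+1)).
congr L2; apply/funext => x; rewrite /apoly subKr; apply: eq_bigr => k _.
by rewrite exprMn (fourier_exp_pow k.+1) mulrA.
Qed.

(** On the circle of radius [r], 1 - [apoly] is a trigonometric polynomial with coefficients b_k
    r^(k+1). This bounds 1 - sum |b_k|^2, the squared norm of the residual of e_(-1), by an integral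
    over the circle. *)
Lemma normsq_apoly_le (b : nat -> R[i]) N :
  normsq lam (fun x => 1 - apoly b N (r%:C * u x)) <= \sum_(k < N) sqn (b k).
Proof.
have -> : (fun x => 1 - apoly b N (r%:C * u x)) =
    fun x => \sum_(k < N) (b k * r%:C ^+ k.+1) * e k.+1 x.
  apply/funext => x; rewrite /apoly subKr; apply: eq_bigr => k _.
  by rewrite exprMn (fourier_exp_pow k.+1) mulrA.
rewrite (@normsq_lam_sum (fun k => b k * r%:C ^+ k.+1)); apply: ler_sum => k _.
have /andP[r0 r1] := r01.
have h : (r ^+ 2) ^+ k.+1 <= 1 by rewrite -exprM exprn_ile1// ltW.
by rewrite sqnM sqnX sqn_real ler_piMr ?sqn_ge0.
Qed.

Definition poisson (t x : R) : R := (1 - r ^+ 2) / sqn (1 - r%:C * u t * (u x)^*).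

Lemma poisson_ge0 t x : 0 <= poisson t x.
Proof.
have /andP[r0 r1] := r01.
by rewrite divr_ge0 ?sqn_ge0// subr_ge0 exprn_ile1// ltW.
Qed.

Let wr t x : sqn (r%:C * u t * (u x)^*) = r ^+ 2.
Proof. by rewrite sqnM sqnJ e1 mulr1 sqn_realM_fourier. Qed.

Lemma poisson_le t x : poisson t x <= (1 - r ^+ 2) / (1 - r) ^+ 2.
Proof.
have /andP[r0 r1] := r01.
rewrite /poisson -sqnV; apply: ler_wpM2l; last exact: sqn_oneBV_le.
by rewrite subr_ge0 exprn_ile1// ltW.
Qed.

Lemma measurable_poisson :
  measurable_fun setT (fun p : R * R => poisson p.1 p.2).
Proof.
have m1 : cmeasurable (fun p : R * R => u p.1) by exact: cmeasurable_comp.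
have m2 : cmeasurable (fun p : R * R => (u p.2)^*).
  by apply: cmeasurableJ; exact: cmeasurable_comp.
have [mq _] : cmeasurable (fun p : R * R => (1 - r%:C * u p.1 * (u p.2)^*)^-1).
  apply: cmeasurableV.
    apply: cmeasurableB; first exact: cmeasurable_cst.
    by apply: cmeasurableM => //; apply: cmeasurableM => //; exact: cmeasurable_cst.
  move=> p; apply/eqP => /sqn_eq0 h; have := oneB_neq0 r01 (wr p.1 p.2).
  by rewrite h eqxx.
rewrite (_ : (fun p => _) = fun p => 2 * complex.Re (1 - r%:C * u p.1 * (u p.2)^*)^-1 - 1).
  by apply: measurable_funB; [apply: measurable_funM => //|]; exact: measurable_cst.
by apply/funext => p; rewrite (Re_oneBV r01 (wr _ _)).
Qed.

Lemma poisson_sym t x : poisson t x = (1 - r ^+ 2) / sqn (1 - r%:C * (u x)^* * u t).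
Proof. by rewrite /poisson mulrAC. Qed.

(** The exact value is 1, but 2 suffices and needs no limit. [D m] is the integrated remainder of
    the geometric series of [q] after [m] terms: it is the same for all m >= 1, because exponentials
    of positive frequency integrate to 0, and it is bounded by r^m / (1 - r). Some large [m] gives
    Re D 1 <= 1/2. *)
Lemma integral_poisson_le2 x : \int[lam]_t poisson t x <= 2.
Proof.
have /andP[r0 r1] := r01.
pose c := r%:C * (u x)^*; pose q t := (1 - c * u t)^-1.
have cr t : sqn (c * u t) = r ^+ 2 by rewrite /c mulrAC wr.
have mcu : cmeasurable (fun t => c * u t).
  by apply: cmeasurableM => //; exact: cmeasurable_cst.
have mq : cmeasurable q.
  apply: cmeasurableV; first by apply: cmeasurableB => //; exact: cmeasurable_cst.
  move=> t; apply/eqP => /sqn_eq0 h; have := oneB_neq0 r01 (cr t).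
  by rewrite h eqxx.
have mX m : cmeasurable (fun t => (c * u t) ^+ m).
  elim: m => [|m IHm]; first by under eq_fun do rewrite expr0; exact: cmeasurable_cst.
  by under eq_fun do rewrite exprS; exact: cmeasurableM.
have sD m t : sqn ((c * u t) ^+ m * q t) <= (r ^+ m / (1 - r)) ^+ 2.
  rewrite sqnM sqnX cr [leRHS]exprMn exprVn -!exprM mulnC ler_wpM2l ?exprn_ge0//.
  exact: sqn_oneBV_le (cr t).
have LD m : L2 lam (fun t => (c * u t) ^+ m * q t).
  by apply: (L2_bounded (@lam1 R) _ (sD m)); exact: cmeasurableM.
pose D m := cintegral lam (fun t => (c * u t) ^+ m * q t).
have iL f : L2 lam f -> cintegrable lam f by exact: L2_integrable (@lam1 R) _.
have D0 m : (0 < m)%N -> D m = D m.+1.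
  move=> m0; transitivity (cintegral lam (fun t => c ^+ m * e m t + (c * u t) ^+ m.+1 * q t)).
    congr cintegral; apply/funext => t.
    rewrite {1}/q (oneBV_rec r01 (cr t)) mulrDr mulr1; congr (_ + _).
      by rewrite exprMn (fourier_exp_pow m).
    by rewrite mulrA -exprSr.
  rewrite cintegralD; [|by apply: cintegrableZ; exact: iL|exact: iL].
  by rewrite cintegralZ ?cintegral_lam_exp ?mulr0 ?add0r//; exact: iL.
have Dm m : D 1%N = D m.+1 by elim: m => // m ->; exact: D0.
have Dsmall m : sqn (D 1%N) <= (r ^+ m.+1 / (1 - r)) ^+ 2.
  rewrite (Dm m); apply: le_trans (sqn_cintegral_le (@lam1 R) (LD m.+1)) _.
  exact: (normsq_bounded (@lam1 R) (LD m.+1) (sD m.+1)).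
have D1 : complex.Re (D 1%N) <= 1 / 2.
  have : (1 - r)^-1 * r ^+ n @[n --> \oo] --> 0.
    by apply: cvg_geometric; rewrite ger0_norm.
  move=> /cvgrPdist_le /(_ (1 / 2)) [|m _ /(_ m.+1 (leqnSn m))]; first by lra.
  have c0 : 0 <= r ^+ m.+1 / (1 - r).
    by rewrite divr_ge0 ?exprn_ge0// subr_ge0 ltW.
  rewrite sub0r normrN mulrC ger0_norm// => h.
  have := Re_le_sqn c0 (Dsmall m); rewrite ler_norml => /andP[_ /le_trans]; exact.
have qE : cintegral lam q = 1 + D 1%N.
  transitivity (cintegral lam (fun t => 1 + (c * u t) ^+ 1 * q t)).
    by congr cintegral; apply/funext => t; rewrite {1}/q (oneBV_rec r01 (cr t)) expr1.
  rewrite cintegralD; [|exact: cintegrable_cst (@lam1 R) _|exact: iL].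
  by rewrite (cintegral_cst (@lam1 R)).
have iq : cintegrable lam q.
  by apply: iL; have := LD 0%N; under [X in L2 _ X]eq_fun do rewrite expr0 mul1r.
have [iq1 _] := iq.
under eq_Rintegral => t _ do rewrite poisson_sym -(Re_oneBV r01 (cr t)).
rewrite RintegralB//; [|exact: integrableZlE|exact: (integrable_cst1 (@lam1 R))].
rewrite RintegralZl// Rintegral_cst// mul1r [X in fine X](@lam1 R).
rewrite -[X in 2 * X]/(complex.Re (cintegral lam q)) qE ReD [complex.Re 1]/= [fine _]/=; lra.
Qed.

(** With a the angle between the two points, |1 - r e^(i a)|^2 = (1 - r)^2 + 2 r (1 - cos a). The
    upper bound on |t - x| keeps the points apart across the endpoint of the interval as well. *)
Lemma poisson_away (eta t x : R) : 0 < r -> 0 < eta <= 2^-1 ->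
  eta <= `|t - x| <= 1 - eta ->
  poisson t x <= (1 - r ^+ 2) / (2 * r * (1 - cos (2 * pi * eta))).
Proof.
move=> r0 /andP[eta0 eta2] /andP[h1 h2]; have /andP[_ r1] := r01.
have c1 : cos (2 * pi * eta) < 1.
  by have := @ltr_cos2pi R eta 0; rewrite mulr0 cos0 => ->; lra.
have cE : complex.Re (r%:C * u t * (u x)^*) = r * cos (2 * pi * `|t - x|).
  rewrite (_ : cos (2 * pi * `|t - x|) = cos (2 * pi * (t - x))); last first.
    rewrite -(cos_norm (2 * pi * (t - x))) normrM ger0_norm//.
    by rewrite mulr_ge0// pi_ge0.
  rewrite mulrBr cosB !ReImE /= /fourier_exp /= !mulr1; ring.
have cle : cos (2 * pi * `|t - x|) <= cos (2 * pi * eta).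
  have [y2|y2] := leP `|t - x| 2^-1.
    have y0 := normr_ge0 (t - x).
    by rewrite leNgt ltr_cos2pi; [rewrite -leNgt|lra|lra].
  by rewrite (cos_sym `|t - x|) leNgt ltr_cos2pi; [rewrite -leNgt; lra|lra|lra].
have pos : 0 < 2 * r * (1 - cos (2 * pi * eta)).
  by rewrite !mulr_gt0// subr_gt0.
apply: ler_wpM2l; first by rewrite subr_ge0 exprn_ile1// ltW.
rewrite lef_pV2 ?posrE//.
  rewrite sqn_oneB wr cE; have := sqr_ge0 (1 - r); nra.
apply: lt_le_trans (sqn_oneB_ge _ (wr _ _)); last exact: ltW.
by rewrite exprn_gt0// subr_gt0.
Qed.

(** By Tonelli the integral in [t] is taken first and contributes at most 2 for each [x]. This
    controls the mass of [nu] near which the kernel may be large. *)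
Lemma integral_poisson_indic (nu : probability R R) (B : set R) : measurable B ->
  (\int[lam]_t \int[nu]_x (poisson t x * \1_B x)%:E <= 2%:E * nu B)%E.
Proof.
move=> mB; pose f (p : R * R) := (poisson p.1 p.2 * \1_B p.2)%:E.
have mf : measurable_fun setT f.
  apply/measurable_EFinP; apply: measurable_funM; first exact: measurable_poisson.
  have mi : measurable_fun setT (\1_B : R -> R) by exact: measurable_indic.
  exact: (measurableT_comp mi measurable_snd).
have f0 p : (0 <= f p)%E by rewrite lee_fin mulr_ge0// poisson_ge0.
rewrite (fubini_tonelli f mf f0) /f /=.
have mi : measurable_fun setT (fun x => (\1_B x)%:E : \bar R).
  by apply/measurable_EFinP; exact: measurable_indic.
have -> : (2%:E * nu B = \int[nu]_x (2%:E * (\1_B x)%:E))%E.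
  by rewrite ge0_integralZl// ?integral_indic ?setIT// => x _; rewrite lee_fin.
apply: ge0_le_integral => //.
- by move=> x _; apply: integral_ge0 => t _; exact: (f0 (t, x)).
- exact: (measurable_fun_fubini_tonelli_G f mf f0).
- exact: measurable_funeM.
move=> x _.
have ip : lam.-integrable setT (EFin \o (fun t => poisson t x)).
  apply: (le_integrable measurableT _ _ (integrable_cst1 (@lam1 R) ((1 - r ^+ 2) / (1 - r) ^+ 2))).
    apply/measurable_EFinP.
    exact: (measurableT_comp measurable_poisson (measurable_pair2 x)).
  move=> t _ /=; rewrite lee_fin ger0_norm ?poisson_ge0//.
  exact: le_trans (poisson_le t x) (ler_norm _).
under eq_integral do rewrite EFinM muleC.
rewrite integralZl//.
rewrite muleC; apply: lee_wpmul2r; first by rewrite lee_fin.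
rewrite -[leLHS]fineK ?lee_fin; last exact: integrable_fin_num.
exact: integral_poisson_le2.
Qed.

End PoissonIntegral.

(** * Singular measures on the circle *)

Section SingularMeasure.
Context {R : realType}.

Local Notation e := (@fourier_exp R).
Local Notation u := (@fourier_exp R 1).
Local Notation lam := (@lam R).

Lemma lam_lebesgue (A : set R) : measurable A ->
  lam A = lebesgue_measure (A `&` `[0, 1]%classic).
Proof.
move=> mA; rewrite -[X in lam X](setIT A) -integral_indic//.
rewrite integral_lam; last by move=> x; rewrite indicE.
  by rewrite integral_indic.
exact: measurable_indic.
Qed.

Lemma lam_le_lebesgue (A : set R) : measurable A -> (lam A <= lebesgue_measure A)%E.
Proof.
by move=> mA; rewrite lam_lebesgue//; apply: le_measure; rewrite ?inE//; exact: measurableI.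
Qed.

Lemma lam_lt (a : R) : 0 <= a -> (lam `]-oo, a[%classic <= a%:E)%E.
Proof.
move=> a0; rewrite lam_lebesgue//.
apply: (@le_trans _ _ (lebesgue_measure `[0, a]%classic)).
  apply: le_measure; rewrite ?inE//; first exact: measurableI.
  by move=> x /=; rewrite !in_itv/= => -[xa /andP[-> _]]; exact: ltW.
rewrite lebesgue_measure_itv/= lte_fin; case: ltP => // _; first by rewrite sube0.
Qed.

Lemma lam_gt (a : R) : a <= 1 -> (lam `]a, +oo[%classic <= (1 - a)%:E)%E.
Proof.
move=> a1; rewrite lam_lebesgue//.
apply: (@le_trans _ _ (lebesgue_measure `[a, 1]%classic)).
  apply: le_measure; rewrite ?inE//; first exact: measurableI.
  move=> x /=; rewrite !in_itv/= andbT => -[xa /andP[_ ->]].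
  by rewrite ltW.
rewrite lebesgue_measure_itv/= lte_fin; case: ltP => // _.
by rewrite lee_fin subr_ge0.
Qed.

Variable nu : probability R R.
Hypothesis nuI : nu Ico01 = 1%E.
Hypothesis nu_sing : singular nu.

(* [nu] lives off [B], Lebesgue measure off [V], and the two complements are at
   distance at least [eta] on the circle. *)
Lemma singular_split (eps : R) : 0 < eps <= 1 / 4 ->
  exists (V B : set R) (eta : R),
    [/\ measurable V /\ measurable B, 0 < eta <= 2^-1,
        (lam V <= (3 * eps)%:E)%E, (nu B <= eps%:E)%E &
        forall t x, ~ V t -> ~ B x -> eta <= `|t - x| <= 1 - eta].
Proof.
move=> /andP[eps0 eps4]; have [N [mN N0 nuN]] := nu_sing.
have [|U [oU NU Ueps]] := lebesgue_regularity_outer mN _ eps0.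
  by rewrite [X in (X < _)%E]N0 ltry.
have mU : measurable U by exact: open_measurable.
have mI := @measurable_Ico01 R.
(* [F n] consists of the points of [0,1) at distance at least [d n] from the complement of the open
   set [U]. These sets exhaust the part of [U] in [0,1), so one of them carries more than 1 - eps of
   the mass of [nu]. *)
pose d n : R := n.+1%:R^-1.
pose C n := \bigcup_(y in ~` U) ball y (d n).
have mC n : measurable (C n).
  by apply: open_measurable; apply: bigcup_open => y _; exact: ball_open.
pose F n := Ico01 `&` ~` C n.
have mF n : measurable (F n) by apply: measurableI => //; exact: measurableC.
have FU : Ico01 `&` U `<=` \bigcup_n F n.
  move=> x [Ix Ux]; have /nbhs_ballP[r /= r0 rU] := open_nbhs_nbhs (conj oU Ux).
  have [n _ nr] := near_infty_natSinv_lt (PosNum r0).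
  exists n => //; split => // -[y Uy]; rewrite /ball /= => yx; apply: Uy; apply: rU.
  by rewrite /ball /= distrC; apply: lt_trans yx (nr n (leqnn n)).
have cvF : nu (F n) @[n --> \oo] --> nu (\bigcup_n F n).
  apply: nondecreasing_cvg_mu => //; first exact: bigcupT_measurable.
  move=> m n mn; apply/subsetPset => x [Ix Cx]; split => // -[y Uy xy]; apply: Cx.
  exists y => //; apply: le_ball xy; rewrite /d lef_pV2 ?posrE ?ltr0n//.
  by rewrite ler_nat ltnS.
have nuF : nu (\bigcup_n F n) = 1%E.
  apply/eqP; rewrite eq_le probability_le1 ?andTb; last exact: bigcupT_measurable.
  have <- : nu (Ico01 `&` U) = 1%E.
    have nuU : nu U = 1%E.
      apply/eqP; rewrite eq_le probability_le1//=.
      have := probability_setC nu (measurableC mN); rewrite setCK nuN sube0 => <-.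
      apply: le_measure; rewrite ?inE//.
    apply/eqP; rewrite eq_le probability_le1//=; last exact: measurableI.
    have := probability_setC nu mI; rewrite nuI subee// => nuIC.
    rewrite -nuU -{1}(setIT U) -(setvU Ico01) setIUr.
    apply: le_trans (measureU2 _ _ _) _; [|exact: measurableI|].
      by apply: measurableI => //; exact: measurableC.
    rewrite [X in (X + _)%E](_ : _ = 0%E) ?add0e; first by rewrite setIC.
    apply/eqP; rewrite eq_le measure_ge0 andbT -nuIC le_measure ?inE//.
      by apply: measurableI => //; exact: measurableC.
    exact: measurableC.
  apply: le_measure => //; rewrite inE; first exact: measurableI.
  exact: bigcupT_measurable.
have [n Fn] : exists n, ((1 - eps)%:E < nu (F n))%E.
  move: cvF; rewrite nuF => /(_ [set y | ((1 - eps)%:E < y)%E]) [].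
    by apply: open_ereal_gt'; rewrite lte_fin ltrBlDr ltrDl.
  by move=> n _ /(_ n (leqnn n)) h; exists n.
pose eta := Num.min (d n) eps.
have d0 : 0 < d n by rewrite invr_gt0 ltr0n.
(* The two collars force eps <= t <= 1 - eps off [V], hence |t - x| <= 1 - eps for every x in [0,1).
   Each of the three pieces has [lam]-measure at most [eps]. *)
exists (U `|` (`]-oo, eps[%classic `|` `]1 - eps, +oo[%classic)), (~` F n), eta; split.
- split; last exact: measurableC.
  by apply: measurableU => //; apply: measurableU.
- rewrite lt_min d0 eps0 /= ge_min; apply/orP; right; lra.
- apply: le_trans (measureU2 _ _ _) _ => //; first exact: measurableU.
  rewrite (_ : 3 * eps = eps + (eps + eps)); last by ring.
  rewrite !EFinD; apply: leeD.
    apply: le_trans (lam_le_lebesgue mU) _.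
    rewrite -(setDUK NU); apply: le_trans (measureU2 _ _ _) _ => //; first exact: measurableD.
    by rewrite [X in (X + _)%E]N0 add0e ltW.
  apply: le_trans (measureU2 _ _ _) _ => //.
  apply: leeD; first by apply: lam_lt; exact: ltW.
  by apply: le_trans (lam_gt _) _; [lra|rewrite lee_fin; lra].
- rewrite probability_setC// leeBlDr; last by rewrite fin_num_measure.
  by rewrite -leeBlDl// -EFinB ltW.
- move=> t x /not_orP[Ut /not_orP[]] /negP + /negP + /contrapT[/andP[x0 x1] Cx].
  rewrite !in_itv/= andbT -!leNgt => t0 t1.
  have tx : d n <= `|t - x|.
    by rewrite leNgt; apply/negP => tx; apply: Cx; exists t.
  rewrite ge_min tx /=; have : eta <= eps by rewrite ge_min lexx orbT.
  rewrite ler_norml; lra.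
Qed.

Lemma vanishing_fourierJ : vanishing nu e (fun x => (u x)^*).
Proof.
have nu1 : nu setT = 1%E by exact: probability_setT.
have me := @cmeasurable_fourier_exp R; have e1 := @sqn_fourier_exp R.
split; first exact: L2_ubar nu1.
(* 28 = 3 + 17 + 8: the measure of [V], the constant 17 of [main], and 4 times the bound 2 [eps] on
   the integral of [P2]. *)
move=> eps0 eps00; pose eps := Num.min (eps0 / 28) (1 / 4).
have eps_gt0 : 0 < eps by rewrite lt_min divr_gt0//; lra.
have eps4 : eps <= 1 / 4 by rewrite ge_min lexx orbT.
have eps28 : 28 * eps <= eps0.
  have : eps <= eps0 / 28 by rewrite ge_min lexx.
  lra.
have [|V [B [eta [[mV mB] eta2 lamV nuB VB]]]] := @singular_split eps.
  by rewrite eps_gt0.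
have /andP[eta0 eta2'] := eta2.
pose k := 1 - cos (2 * pi * eta).
have k0 : 0 < k.
  by rewrite subr_gt0; have := @ltr_cos2pi R eta 0; rewrite mulr0 cos0 => ->; lra.
have k2 : k <= 2 by have := cos_geN1 (2 * pi * eta); rewrite /k; lra.
(* Then 1 - r^2 <= 2 (1 - r) = eps k / 2, which is below eps times 2 r k, so [poisson_away] bounds
   the kernel by [eps] off [V] and [B]. *)
pose r := 1 - eps * k / 4.
have ek : 0 < eps * k <= 1 / 2.
  by rewrite mulr_gt0//=; nra.
have r0 : 0 < r by rewrite /r; lra.
have r1 : r < 1 by rewrite /r; lra.
have r01 : 0 <= r < 1 by rewrite ltW.
have P1 t x : ~ V t -> ~ B x -> poisson r t x <= eps.
  move=> Vt Bx; apply: le_trans (poisson_away r01 r0 eta2 (VB t x Vt Bx)) _.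
  rewrite -/k ler_pdivrMr; last by rewrite !mulr_gt0.
  rewrite /r; nra.
have [N hN] : exists N, r ^+ N.+1 / (1 - r) <= eps.
  have : (1 - r)^-1 * r ^+ n @[n --> \oo] --> 0.
    by apply: cvg_geometric; rewrite ger0_norm// ltW.
  move=> /cvgrPdist_le /(_ eps eps_gt0) [N _ /(_ N.+1 (leqnSn N))].
  have c0 : 0 <= r ^+ N.+1 / (1 - r) by apply: divr_ge0; [apply: exprn_ge0; exact: ltW|rewrite subr_ge0 ltW].
  by rewrite sub0r normrN mulrC ger0_norm// => h; exists N.
exists N; rewrite -normsq_ppoly// normsq_ppolyE//.
pose b n := inner nu (residual nu e (fun x => (u x)^*) n) (e n).
pose A t := apoly b N (r%:C * u t).
pose P2 t := \int[nu]_x (poisson r t x * \1_B x).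
(* The left side is the squared norm of the residual, the right side the integral of 1 - |1 - A|^2
   over the circle. *)
have c_le : 1 - \sum_(k < N) sqn (b k) <= 1 - normsq lam (fun t => 1 - A t).
  by rewrite lerD2l lerN2; exact: normsq_apoly_le.
apply: le_trans c_le _.
have miB : measurable_fun setT (\1_B : R -> R) by exact: measurable_indic.
have mpx t : measurable_fun setT (poisson r t).
  exact: (measurableT_comp (measurable_poisson r01) (measurable_pair1 t)).
have ipB (h : R -> R) t : measurable_fun setT h -> (forall x, 0 <= h x <= 1) ->
    nu.-integrable setT (fun x => (poisson r t x * h x)%:E).
  move=> mh h01; apply: (le_integrable measurableT _ _
      (integrable_cst1 nu1 ((1 - r ^+ 2) / (1 - r) ^+ 2))).
    by apply/measurable_EFinP; exact: measurable_funM.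
  move=> x _ /=; rewrite lee_fin; have /andP[h0 h1] := h01 x.
  rewrite !ger0_norm; last 2 first.
  - exact: le_trans (poisson_ge0 r01 t x) (poisson_le r01 t x).
  - by rewrite mulr_ge0// poisson_ge0.
  apply: le_trans (poisson_le r01 t x).
  by rewrite ler_piMr// poisson_ge0.
have B01 x : 0 <= (\1_B x : R) <= 1 by rewrite indicE ler0n lern1 leq_b1.
have P2_0 t : 0 <= P2 t.
  apply: Rintegral_ge0 => x _; have /andP[h0 _] := B01 x.
  by rewrite mulr_ge0// poisson_ge0.
have P2E t : (\int[nu]_x (poisson r t x * \1_B x)%:E = (P2 t)%:E)%E.
  by rewrite -[LHS]fineK//; apply: integrable_fin_num => //; exact: ipB.
have mP2 : measurable_fun setT (fun t => (P2 t)%:E).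
  under eq_fun do rewrite -P2E.
  apply: (measurable_fun_fubini_tonelli_F (m2 := nu)
    (fun p : R * R => (poisson r p.1 p.2 * \1_B p.2)%:E)).
    apply/measurable_EFinP; apply: measurable_funM; first exact: measurable_poisson.
    exact: (measurableT_comp miB measurable_snd).
  by move=> p; rewrite lee_fin mulr_ge0 ?poisson_ge0//; have /andP[] := B01 p.2.
have intP2 : (\int[lam]_t (P2 t)%:E <= (2 * eps)%:E)%E.
  under eq_integral do rewrite -P2E.
  apply: le_trans (integral_poisson_indic r01 nu mB) _.
  by rewrite EFinM lee_wpmul2l ?lee_fin.
have iP2 : lam.-integrable setT (fun t => (P2 t)%:E).
  apply/integrableP; split => //.
  under eq_integral do rewrite gee0_abs ?lee_fin//.
  by apply: le_lt_trans intP2 _; rewrite ltry.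
(* On [V] the trivial bound 1 is used. Off [V] the Poisson integral is at most [eps] from outside
   [B] plus [P2 t] from [B]; its factor 4 and the truncation error 13 [eps] give 17. *)
have main t : 1 - sqn (1 - A t) <= \1_V t + (17 * eps + 4 * P2 t).
  rewrite indicE; have [|/negP] := boolP (t \in V); rewrite inE => Vt /=.
    have := sqn_ge0 (1 - A t); have := P2_0 t; lra.
  rewrite add0r.
  have zr : sqn (r%:C * u t) = r ^+ 2 by exact: sqn_realM_fourier.
  have := one_sub_sqn_apoly_le nu1 r01 zr N r0; rewrite -/b -/(A t).
  have : \int[nu]_x (poisson r t x) <= eps + P2 t.
    have -> : eps + P2 t = \int[nu]_x (eps + poisson r t x * \1_B x).
      rewrite RintegralD//; [|exact: (integrable_cst1 nu1)|exact: ipB].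
      by rewrite Rintegral_cst// [X in fine X]nu1 mulr1.
    apply: le_Rintegral => //.
    - have := ipB (fun _ => 1) t (measurable_cst _).
      by under eq_fun do rewrite mulr1; apply => x; rewrite ler01 lexx.
    - by apply: integrableDE; [exact: (integrable_cst1 nu1)|exact: ipB].
    - move=> x _; rewrite indicE; have [|/negP] := boolP (x \in B); rewrite inE => Bx.
        by rewrite mulr1 lerDr ltW.
      by rewrite mulr0 addr0 P1.
  rewrite /poisson; lra.
have iV : lam.-integrable setT (fun t => (\1_V t)%:E). exact: integrable_indic.
have /L2P[mA iA] := L2_apoly r b N.
have -> : 1 - normsq lam (fun t => 1 - A t) = \int[lam]_t (1 - sqn (1 - A t)).
  rewrite RintegralB//; last exact: (integrable_cst1 (@lam1 R)).
  rewrite Rintegral_cst// [X in fine X](@lam1 R) mulr1.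
  by congr (_ - _); rewrite /normsq L2normsqE.
have i17 : lam.-integrable setT (EFin \o (fun t => 17 * eps + 4 * P2 t)).
  apply: integrableDE; first exact: (integrable_cst1 (@lam1 R)).
  exact: integrableZlE.
apply: (@le_trans _ _ (\int[lam]_t (\1_V t + (17 * eps + 4 * P2 t)))).
  apply: le_Rintegral => //.
    by apply: integrableBE; first exact: (integrable_cst1 (@lam1 R)).
  exact: integrableDE.
rewrite RintegralD// RintegralD//; last 2 first.
- exact: (integrable_cst1 (@lam1 R)).
- exact: integrableZlE.
rewrite Rintegral_cst// RintegralZl// [X in fine X](@lam1 R) mulr1.
have hV : \int[lam]_t \1_V t <= 3 * eps.
  by rewrite /Rintegral integral_indic// setIT -lee_fin fineK// fin_num_measure.
have hP : \int[lam]_t P2 t <= 2 * eps.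
  by rewrite /Rintegral -lee_fin fineK//; exact: integrable_fin_num.
move: hV hP; lra.
Qed.

End SingularMeasure.

(** * The Parseval identity in one variable *)

Section OneDimensionalParseval.
Context {R : realType}.
Variable nu : {measure set R -> \bar R}.
Hypothesis nu1 : nu setT = 1%E.

(** Slices are given as measures of mass one; a second name for [nu] can carry the probability
    structure that the singular case asks for. *)
Definition as_probability : set R -> \bar R := nu.

HB.instance Definition _ := Measure.on as_probability.

HB.instance Definition _ :=
  Measure_isProbability.Build _ _ _ as_probability nu1.

Lemma probability_of : exists P : probability R R, P = nu :> {measure set R -> \bar R}.
Proof. by exists as_probability; exact: eq_measure. Qed.

Lemma aux_seq_parseval (f : R -> R[i]) : nu Ico01 = 1%E -> singular nu ->
  L2 nu f ->
  L2normsq nu f = (\esum_(n in [set: nat]) (sqn (inner nu f (aux_seq nu n)))%:E)%E.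
Proof.
move: nu1; have [P <-] := probability_of => P1 PI Psing Lf.
have me := @cmeasurable_fourier_exp R; have e1 := @sqn_fourier_exp R.
apply: (vanishing_parseval P1 me e1).
exact: (vanishing_L2 P1 (vanishing_fourierJ PI Psing) PI).
Qed.

End OneDimensionalParseval.

(** * Slices *)

Section KernelIntegrals.
Context {disp : measure_display} {X : measurableType disp} {R : realType}.
Variable gam : R.-pker X ~> R.
Implicit Types (f g : X * R -> R[i]).

Let gam1 x : gam x setT = 1%E := prob_kernel x.

Lemma measurable_kernel_integral (h : X * R -> \bar R) :
  measurable_fun setT h -> (forall z, (0 <= h z)%E) ->
  measurable_fun setT (fun x => \int[gam x]_t h (x, t))%E.
Proof. by move=> mh h0; exact: measurable_fun_integral_sfinite_kernel. Qed.

Lemma measurable_kernel_Rintegral (h : X * R -> R) : measurable_fun setT h ->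
  measurable_fun setT (fun x => \int[gam x]_t h (x, t)).
Proof.
move=> mh; have mhE : measurable_fun setT (EFin \o h) by exact/measurable_EFinP.
rewrite /Rintegral; apply: measurableT_comp => //.
under eq_fun do rewrite integralE.
apply: emeasurable_funB.
- have p0 z : (0 <= (EFin \o h)^\+%E z)%E by exact: funepos_ge0.
  have := measurable_kernel_integral (measurable_funepos mhE) p0.
  by congr measurable_fun; apply/funext => x; apply: eq_integral => t _; rewrite ?funeposE ?funenegE.
- have n0 z : (0 <= (EFin \o h)^\-%E z)%E by exact: funeneg_ge0.
  have := measurable_kernel_integral (measurable_funeneg mhE) n0.
  by congr measurable_fun; apply/funext => x; apply: eq_integral => t _; rewrite ?funeposE ?funenegE.
Qed.

Lemma cmeasurable_kernel_cintegral f : cmeasurable f ->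
  cmeasurable (fun x => cintegral (gam x) (fun t => f (x, t))).
Proof.
move=> [m1 m2]; split.
- exact: (@measurable_kernel_Rintegral (fun z => complex.Re (f z))).
- exact: (@measurable_kernel_Rintegral (fun z => complex.Im (f z))).
Qed.

Lemma cmeasurable_section f x : cmeasurable f -> cmeasurable (fun t => f (x, t)).
Proof. by move=> mf; exact: (cmeasurable_comp mf (measurable_pair1 x)). Qed.

Lemma cmeasurable_kernel_inner f g : cmeasurable f -> cmeasurable g ->
  cmeasurable (fun x => inner (gam x) (fun t => f (x, t)) (fun t => g (x, t))).
Proof.
move=> mf mg.
apply: (@cmeasurable_kernel_cintegral (fun z => f z * (g z)^*)).
by apply: cmeasurableM => //; exact: cmeasurableJ.
Qed.

Definition csqn_bounded {T : Type} (f : T -> R[i]) := exists C, forall z, sqn (f z) <= C.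

Let aux (n : nat) (z : X * R) : R[i] := aux_seq (gam z.1) n z.2.

Let coef n k x := inner (gam x) (fourier_exp n) (fourier_exp k).

Lemma cmeasurable_coef n k : cmeasurable (coef n k).
Proof.
apply: (@cmeasurable_kernel_inner (fun z => fourier_exp n z.2) (fun z => fourier_exp k z.2));
  by apply: cmeasurable_comp => //; exact: cmeasurable_fourier_exp.
Qed.

Lemma aux_pairE n : aux n = fun z => fourier_exp n z.2 -
  \sum_(k < n) coef n k z.1 * aux k z.
Proof.
apply/funext => z.
have aE k : aux k z = gram_seq (gam z.1) (@fourier_exp R) k z.2 by [].
by rewrite aE gram_seqE; congr (_ - _); apply: eq_bigr => k _.
Qed.

(** Measurability is joint in the base point and the variable: the coefficients of the recursion are
    kernel integrals, hence measurable in the base point. *)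
Lemma cmeasurable_aux_seq n : cmeasurable (fun z : X * R => aux_seq (gam z.1) n z.2).
Proof.
rewrite -/(aux n); elim/ltn_ind: n => n IHn; rewrite aux_pairE.
apply: cmeasurableB.
  by apply: cmeasurable_comp => //; exact: cmeasurable_fourier_exp.
have := @cmeasurable_sum _ _ R 'I_n (index_enum 'I_n)
  (fun k z => coef n k z.1 * aux k z); apply => k.
apply: cmeasurableM; last exact: IHn.
by apply: cmeasurable_comp => //; exact: cmeasurable_coef.
Qed.

Lemma bounded_aux_seq n : csqn_bounded (fun z : X * R => aux_seq (gam z.1) n z.2).
Proof.
have [C hC] := gram_seq_bounded n (@cmeasurable_fourier_exp R) (@sqn_fourier_exp R).
by exists C => z; exact: hC.
Qed.

Lemma L2_aux_seq n x : L2 (gam x) (aux_seq (gam x) n).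
Proof.
apply: (L2_gram_seq (gam1 x)); first exact: cmeasurable_fourier_exp.
exact: sqn_fourier_exp.
Qed.

(* The closed form of [G(n,k)]; the two agree almost everywhere. *)
Definition slice_coef n f x : R[i] :=
  inner (gam x) (fun t => f (x, t)) (aux_seq (gam x) n).

Lemma cmeasurable_slice_coef n f : cmeasurable f -> cmeasurable (slice_coef n f).
Proof.
move=> mf; apply: (@cmeasurable_kernel_inner f (fun z => aux_seq (gam z.1) n z.2)) => //.
exact: cmeasurable_aux_seq.
Qed.

Lemma slice_opE n f x :
  slice_op gam n f x = inner (gam x) (fun t => f (x, t)) (fourier_exp n).
Proof.
by rewrite /slice_op /inner; congr cintegral; apply/funext => t; rewrite expiN.
Qed.

Lemma cmeasurable_slice_op n f : cmeasurable f -> cmeasurable (slice_op gam n f).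
Proof.
move=> mf; apply: (@cmeasurable_kernel_cintegral
  (fun z => f z * expi (- (2 * pi * n%:R * z.2)))).
apply: cmeasurableM => //.
under eq_fun do rewrite expiN; apply: cmeasurableJ.
apply: (@cmeasurable_comp _ _ _ _ _ (fourier_exp n)) => //.
exact: cmeasurable_fourier_exp.
Qed.

(** Extended reals make the bound valid for every [x], including sections of infinite norm. *)
Lemma sqn_slice_op_le n f x : cmeasurable f ->
  ((sqn (slice_op gam n f x))%:E <= L2normsq (gam x) (fun t => f (x, t)))%E.
Proof.
move=> mf; have := leey (L2normsq (gam x) (fun t => f (x, t))).
rewrite le_eqVlt => /predU1P[->|foo]; first exact: leey.
have Lf : L2 (gam x) (fun t => f (x, t)).
  by split => //; exact: cmeasurable_section.
rewrite L2_normsqE// lee_fin slice_opE.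
apply: (sqn_inner_unimodular_le (gam1 x)) => //; first exact: cmeasurable_fourier_exp.
exact: sqn_fourier_exp.
Qed.

(** The recursion of the auxiliary sequence sits in the conjugate-linear slot, so [coef n j] becomes
    [coef j n], the factor that [slice_op_adjoint] produces. *)
Lemma slice_coef_rec n f x : L2 (gam x) (fun t => f (x, t)) ->
  slice_coef n f x = slice_op gam n f x -
    \sum_(j < n) slice_coef j f x * coef j n x.
Proof.
move=> Lf; have me := @cmeasurable_fourier_exp R; have e1 := @sqn_fourier_exp R.
have Le := L2_unimodular (gam1 x) me e1.
rewrite slice_opE /slice_coef.
have -> : aux_seq (gam x) n = fun t =>
    fourier_exp n t - \sum_(k < n) coef n k x * aux_seq (gam x) k t.
  exact: (@gram_seqE _ _ _ (gam x) (@fourier_exp R) n).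
have La k := L2_aux_seq k x.
rewrite innerBr//; last by apply: L2_sum => k; exact: L2Z.
congr (_ - _); rewrite inner_sumr//; last by move=> k; exact: L2Z.
by apply: eq_bigr => j _; rewrite innerZr// mulrC /coef (innerJ (Le n) (Le j)).
Qed.

End KernelIntegrals.

(** * Disintegration, adjoints of the slice operators and the operators G(n,k) *)

Section Disintegration.
Context {disp : measure_display} {X : measurableType disp} {R : realType}.
Variables (mu : probability (X * R)%type R) (gam : R.-pker X ~> R) (D : set X).
Hypothesis slices : slice_measures D mu gam.
Implicit Types (f g : X * R -> R[i]).

Local Notation nu := (marginal mu).

Let gam1 x : gam x setT = 1%E := prob_kernel x.

Lemma L2normsq_disintegration f : cmeasurable f -> L2normsq mu f =
  (\int[nu]_x L2normsq (gam x) (fun t => f (x, t)))%E.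
Proof.
move=> mf; rewrite L2normsqE slices.2 => [|//|z]; last by rewrite lee_fin sqn_ge0.
- by apply: eq_integral => x _; rewrite L2normsqE.
- exact: measurable_sqnE.
Qed.

Lemma measurable_L2normsq_section f : cmeasurable f ->
  measurable_fun setT (fun x => L2normsq (gam x) (fun t => f (x, t))).
Proof.
move=> mf; under eq_fun do rewrite L2normsqE.
apply: (@measurable_kernel_integral _ _ _ gam (fun z => (sqn (f z))%:E)).
  exact: measurable_sqnE.
by move=> z; rewrite lee_fin sqn_ge0.
Qed.

Lemma ae_L2_section f : L2 mu f -> {ae nu, forall x, L2 (gam x) (fun t => f (x, t))}.
Proof.
move=> [mf foo]; rewrite L2normsq_disintegration// in foo.
have : nu.-integrable setT (fun x => L2normsq (gam x) (fun t => f (x, t))).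
  apply/integrableP; split; first exact: measurable_L2normsq_section.
  by under eq_integral do rewrite gee0_abs ?L2normsq_ge0//.
move=> /(integrable_ae measurableT); apply: filterS => x /(_ Logic.I).
rewrite ge0_fin_numE ?L2normsq_ge0// => fx; split => //.
exact: cmeasurable_section.
Qed.

(** Slice measures are characterised on nonnegative functions, so the positive and negative parts
    are disintegrated separately. Their fibre integrals are finite only almost everywhere, and only
    there does [fine] respect the difference. *)
Lemma disintegration_Rintegral (g : X * R -> R) :
  mu.-integrable setT (EFin \o g) ->
  nu.-integrable setT (EFin \o (fun x => \int[gam x]_t g (x, t))) /\
  \int[mu]_z g z = \int[nu]_x \int[gam x]_t g (x, t).
Proof.
move=> ig; have mgE := measurable_int _ ig.
have mg : measurable_fun setT g by exact/measurable_EFinP.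
pose P x := (\int[gam x]_t (EFin \o g)^\+ (x, t))%E.
pose N x := (\int[gam x]_t (EFin \o g)^\- (x, t))%E.
have p0 z : (0 <= (EFin \o g)^\+%E z)%E by exact: funepos_ge0.
have n0 z : (0 <= (EFin \o g)^\-%E z)%E by exact: funeneg_ge0.
have mp := measurable_funepos mgE; have mn := measurable_funeneg mgE.
have mP : measurable_fun setT P by exact: measurable_kernel_integral.
have mN : measurable_fun setT N by exact: measurable_kernel_integral.
have P0 x : (0 <= P x)%E by exact: integral_ge0.
have N0 x : (0 <= N x)%E by exact: integral_ge0.
have eP : (\int[mu]_z (EFin \o g)^\+ z = \int[nu]_x P x)%E by rewrite slices.2.
have eN : (\int[mu]_z (EFin \o g)^\- z = \int[nu]_x N x)%E by rewrite slices.2.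
have iP : nu.-integrable setT P.
  apply/integrableP; split => //.
  under eq_integral do rewrite gee0_abs//.
  by rewrite -eP; exact: (integral_funepos_lt_pinfty measurableT ig).
have iN : nu.-integrable setT N.
  apply/integrableP; split => //.
  under eq_integral do rewrite gee0_abs//.
  by rewrite -eN; exact: (integral_funeneg_lt_pinfty measurableT ig).
have gE x : \int[gam x]_t g (x, t) = fine (P x - N x)%E.
  rewrite /Rintegral integralE; congr (fine (_ - _)%E);
    by apply: eq_integral => t _; rewrite ?funeposE ?funenegE.
have aePN : {ae nu, forall x, setT x -> (P x - N x)%E = (\int[gam x]_t g (x, t))%:E}.
  have := integrable_ae measurableT iP; have := integrable_ae measurableT iN.
  apply: filterS2 => x /(_ Logic.I) fN /(_ Logic.I) fP _.
  by rewrite gE fineK// fin_numB fP fN.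
have iPN := integrableB measurableT iP iN.
have mG : measurable_fun setT (EFin \o (fun x => \int[gam x]_t g (x, t))).
  by apply/measurable_EFinP; exact: measurable_kernel_Rintegral.
have mPN := measurable_int _ iPN.
split.
  apply/integrableP; split => //.
  have /integrableP[_] := iPN; apply: le_lt_trans.
  rewrite le_eqVlt; apply/predU1P; left; apply: ae_eq_integral => //.
  - exact: measurableT_comp.
  - exact: measurableT_comp.
  - by apply: filterS aePN => x /(_ Logic.I) h _ /=; rewrite h.
have -> : \int[mu]_z g z = fine (\int[mu]_z (EFin \o g) z)%E by [].
rewrite integralE eP eN -integralB//; congr fine.
exact: ae_eq_integral.
Qed.

Lemma disintegration_cintegral f : cintegrable mu f ->
  cintegral mu f = cintegral nu (fun x => cintegral (gam x) (fun t => f (x, t))).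
Proof.
move=> [i1 i2]; have [_ e1] := disintegration_Rintegral i1.
have [_ e2] := disintegration_Rintegral i2.
by rewrite /cintegral e1 e2.
Qed.

Lemma L2_comp_fst (h : X -> R[i]) : L2 nu h -> L2 mu (fun z => h z.1).
Proof.
move=> [mh hoo]; have m1 : cmeasurable (fun z : X * R => h z.1) by exact: cmeasurable_comp.
split => //; rewrite L2normsq_disintegration//.
apply: le_lt_trans hoo; rewrite [leRHS]L2normsqE le_eqVlt; apply/predU1P; left.
apply: eq_integral => x _; rewrite L2normsqE /= integral_cst//.
by rewrite [X in (_ * X)%E]gam1 mule1.
Qed.

Lemma L2_mul_comp_fst (phi : X * R -> R[i]) (h : X -> R[i]) :
  cmeasurable phi -> csqn_bounded phi -> L2 nu h ->
  L2 mu (fun z => phi z * h z.1).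
Proof.
by move=> mphi [C hC] Lh; apply: (L2M_bounded (L2_comp_fst Lh) mphi hC).
Qed.

(** On almost every fibre [f] is square-integrable, and [h] is constant there, so it leaves the
    inner integral. *)
Lemma inner_disintegration f (phi : X * R -> R[i]) (h : X -> R[i]) :
  L2 mu f -> cmeasurable phi -> csqn_bounded phi -> L2 nu h ->
  inner mu f (fun z => phi z * h z.1) =
  inner nu (fun x => inner (gam x) (fun t => f (x, t)) (fun t => phi (x, t))) h.
Proof.
move=> Lf mphi bphi Lh; have Lk := L2_mul_comp_fst mphi bphi Lh.
have [mf _] := Lf; have [mh _] := Lh.
rewrite {1}/inner disintegration_cintegral; last exact: L2_inner_integrable.
apply: ae_eq_cintegral.
- apply: (@cmeasurable_kernel_cintegral _ _ _ gam (fun z => f z * (phi z * h z.1)^*)).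
  apply: cmeasurableM => //; apply: cmeasurableJ.
  by apply: cmeasurableM => //; exact: cmeasurable_comp.
- apply: cmeasurableM; last exact: cmeasurableJ.
  exact: cmeasurable_kernel_inner.
apply: filterS (ae_L2_section Lf) => x Lfx.
have Lphix : L2 (gam x) (fun t => phi (x, t)).
  have [C hC] := bphi; apply: (L2_bounded (gam1 x) (c := C)) => //.
  exact: cmeasurable_section.
rewrite mulrC /inner -cintegralZ; last exact: L2_inner_integrable.
congr cintegral; apply/funext => t /=.
by apply: eq_Re_Im; rewrite !ReImE; ring.
Qed.

Lemma L2_slice_op n f : L2 mu f -> L2 nu (slice_op gam n f).
Proof.
move=> [mf foo]; split; first exact: cmeasurable_slice_op.
apply: le_lt_trans foo; rewrite L2normsqE (L2normsq_disintegration mf).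
apply: ge0_le_integral => //.
- by move=> x _; rewrite lee_fin sqn_ge0.
- by apply: measurable_sqnE; exact: cmeasurable_slice_op.
- exact: measurable_L2normsq_section.
- by move=> x _; exact: sqn_slice_op_le.
Qed.

Let exp2 n (z : X * R) : R[i] := fourier_exp n z.2.

Let cmeasurable_exp2 n : cmeasurable (exp2 n).
Proof. by apply: cmeasurable_comp => //; exact: cmeasurable_fourier_exp. Qed.

Let bounded_exp2 n : csqn_bounded (exp2 n).
Proof. by exists 1 => z; rewrite sqn_fourier_exp. Qed.

Let slice_op_exp2 n f : slice_op gam n f =
  fun x => inner (gam x) (fun t => f (x, t)) (fun t => exp2 n (x, t)).
Proof. by apply/funext => x; rewrite slice_opE. Qed.

(** A witness shows that [xget] does not fall back on its default value 0. *)
Lemma adjoint_slice_opP j (h : X -> R[i]) : L2 nu h ->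
  let k := adjoint mu nu (slice_op gam j) h in
  L2 mu k /\ forall f, L2 mu f -> inner nu (slice_op gam j f) h = inner mu f k.
Proof.
move=> Lh /=; apply: (@xgetPex _ 0 [set k | L2 mu k /\
  forall f, L2 mu f -> inner nu (slice_op gam j f) h = inner mu f k]).
exists (fun z => exp2 j z * h z.1); split; first exact: L2_mul_comp_fst.
move=> f Lf.
have -> := inner_disintegration Lf (cmeasurable_exp2 j) (bounded_exp2 j) Lh.
by rewrite slice_op_exp2.
Qed.

(* The adjoint is only determined almost everywhere. *)
Lemma slice_op_adjoint n j (h : X -> R[i]) : L2 nu h ->
  {ae nu, forall x, slice_op gam n (adjoint mu nu (slice_op gam j) h) x =
    h x * inner (gam x) (fourier_exp j) (fourier_exp n)}.
Proof.
move=> Lh; have [] := adjoint_slice_opP j Lh.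
set k := adjoint _ _ _ _ => Lk kP.
pose k0 z := exp2 j z * h z.1.
have Lk0 : L2 mu k0 by exact: L2_mul_comp_fst.
have Ld := L2B Lk Lk0.
(* Both [k] and [k0] satisfy the adjoint identity; tested against their own difference, it gives
   norm zero. *)
have d0 : L2normsq mu (fun z => k z - k0 z) = 0%E.
  rewrite L2_normsqE//; congr EFin; apply: complexI; rewrite -inner_self.
  rewrite [LHS]innerBr// -kP// /k0.
  have -> := inner_disintegration Ld (cmeasurable_exp2 j) (bounded_exp2 j) Lh.
  by rewrite (slice_op_exp2 j (fun z => k z - k0 z)) subrr.
have mk : cmeasurable k by exact: L2_measurable Lk.
have mk0 : cmeasurable k0 by exact: L2_measurable Lk0.
have md := L2_measurable Ld.
rewrite L2normsq_disintegration// in d0.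
have : ae_eq nu setT (fun x => L2normsq (gam x) (fun t => k (x, t) - k0 (x, t))) (cst 0%E).
  apply/ae_eq_integral_abs => //.
    exact: (measurable_L2normsq_section (f := fun z => k z - k0 z)).
  by under eq_integral do rewrite gee0_abs ?L2normsq_ge0//.
apply: filterS => x /(_ Logic.I) /= dx.
have me := @cmeasurable_fourier_exp R; have e1 := @sqn_fourier_exp R.
have Le := L2_unimodular (gam1 x) me e1.
rewrite slice_opE -innerZl//.
apply: ae_eq_inner => //; first exact: cmeasurable_section.
  by apply: cmeasurableM => //; exact: cmeasurable_cst.
have mdx : cmeasurable (fun t => k (x, t) - k0 (x, t)).
  exact: (cmeasurable_section x md).
apply: filterS (L2normsq_eq0 mdx dx) => t /eqP; rewrite subr_eq0 => /eqP ->.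
by rewrite /k0 mulrC.
Qed.

(** The two claims are proved together, since the adjoint is characterised only on square-integrable
    arguments and hence needs the first claim at all smaller indices. *)
Lemma kaczmarz_opP n f : L2 mu f ->
  L2 nu (kaczmarz_op mu gam n f) /\
  {ae nu, forall x, kaczmarz_op mu gam n f x = slice_coef gam n f x}.
Proof.
move=> Lf; elim/ltn_ind: n => n IHn.
pose term j x := slice_op gam n
  (adjoint mu nu (slice_op gam j) (kaczmarz_op mu gam j f)) x.
have kE x : kaczmarz_op mu gam n f x =
    slice_op gam n f x - \sum_(j < n) term j x.
  by rewrite kaczmarz_opE fctE fct_sumE.
split.
  rewrite (_ : kaczmarz_op _ _ _ _ = fun x => slice_op gam n f x - \sum_(j < n) term j x);
    last by apply/funext.
  apply: L2B; first exact: L2_slice_op.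
  have := @L2_sum _ _ _ nu 'I_n (index_enum 'I_n) term; apply => j.
  by apply: L2_slice_op; have [] := adjoint_slice_opP j (IHn j (ltn_ord j)).1.
have H : {ae nu, forall x (j : nat), (j < n)%N ->
    term j x = slice_coef gam j f x * inner (gam x) (fourier_exp j) (fourier_exp n)}.
  apply/ae_foralln => j; have [jn|jn] := boolP (j < n)%N; last exact: aeW.
  have [Lj aej] := IHn j jn.
  by apply: filterS2 (slice_op_adjoint n j Lj) aej => x E1 E2 _; rewrite /term E1 E2.
apply: filterS2 H (ae_L2_section Lf) => x Hx Lfx.
rewrite kE slice_coef_rec//; congr (_ - _); apply: eq_bigr => j _.
by rewrite Hx.
Qed.

Lemma inner_kaczmarz_op n f (h : X -> R[i]) : L2 mu f -> L2 nu h ->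
  inner nu (kaczmarz_op mu gam n f) h =
  inner mu f (fun z => aux_seq (gam z.1) n z.2 * h z.1).
Proof.
move=> Lf Lh; have [Lk aek] := kaczmarz_opP n Lf.
have [mf _] := Lf; have [mh _] := Lh; have [mk _] := Lk.
rewrite (inner_disintegration (phi := fun z => aux_seq (gam z.1) n z.2))//.
- apply: ae_eq_inner => //.
  exact: cmeasurable_slice_coef.
- exact: cmeasurable_aux_seq.
- exact: bounded_aux_seq.
Qed.

Lemma L2_slice_coef n f : L2 mu f -> L2 nu (slice_coef gam n f).
Proof.
move=> Lf; have [[mk koo] aek] := kaczmarz_opP n Lf; have [mf _] := Lf.
split; first exact: cmeasurable_slice_coef.
apply: le_lt_trans koo; rewrite !L2normsqE le_eqVlt; apply/predU1P; left.
apply: ae_eq_integral => //.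
- by apply: measurable_sqnE; exact: cmeasurable_slice_coef.
- exact: measurable_sqnE.
- by apply: filterS aek => x -> _.
Qed.

(** The one-variable identity on almost every slice, integrated; nonnegativity allows the sum and
    the integral to be exchanged. Slices are known to sit on [0,1) only over [D], which therefore
    must have full marginal measure. *)
Lemma L2normsq_slice_coef f : nu D = 1%E -> measurable D ->
  {ae nu, forall x, singular (gam x)} -> L2 mu f ->
  L2normsq mu f = (\esum_(n in [set: nat]) L2normsq nu (slice_coef gam n f))%E.
Proof.
move=> nuD mD sing Lf; have [mf _] := Lf.
have msc n : measurable_fun setT (fun x => (sqn (slice_coef gam n f x))%:E).
  by apply: measurable_sqnE; exact: cmeasurable_slice_coef.
rewrite -nneseries_esumT; last by move=> n; exact: L2normsq_ge0.
under eq_eseriesr do rewrite L2normsqE.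
rewrite -integral_nneseries//; last by move=> n x _; rewrite lee_fin sqn_ge0.
rewrite L2normsq_disintegration//; apply: ae_eq_integral => //.
- exact: measurable_L2normsq_section.
- by apply: ge0_emeasurable_sum => // n x _ _; rewrite lee_fin sqn_ge0.
have aeD : {ae nu, forall x, D x}.
  exists (~` D); split => //; first exact: measurableC.
  by rewrite [LHS]probability_setC// nuD subee.
apply: filterS3 aeD sing (ae_L2_section Lf) => x Dx sx Lfx _.
rewrite nneseries_esumT; last by move=> n; rewrite lee_fin sqn_ge0.
by apply: aux_seq_parseval => //; exact: slices.1.
Qed.

End Disintegration.

(** * Induction on the number of variables *)

Section IteratedParseval.
Context {R : realType}.
Variable gam : forall m : nat, R.-pker (box R m) ~> R.

Lemma measurable_cube m : measurable (cube R m).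
Proof.
elim: m => [|m IHm]; first exact: measurable_Ico01.
exact: (measurableX IHm (@measurable_Ico01 R)).
Qed.

Lemma marginal_cube m (mu : probability (box R m.+1) R) :
  mu (cube R m.+1) = 1%E -> marginal mu (cube R m) = 1%E.
Proof.
move=> mu1; apply/eqP; rewrite eq_le probability_le1; last exact: measurable_cube.
rewrite -mu1 /=; apply: le_measure; rewrite ?inE.
- exact: (@measurable_cube m.+1).
- by rewrite -[X in measurable X]setTI; apply: measurable_fst => //; exact: measurable_cube.
- by move=> z [].
Qed.

Lemma aux_prod_bounded n m (mu : probability (box R m) R) :
  cmeasurable (aux_prod gam n mu) /\ csqn_bounded (aux_prod gam n mu).
Proof.
elim: m mu => [|m IHm] mu.
  have mu1 : mu setT = 1%E by exact: probability_setT.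
  split.
    exact: (cmeasurable_gram_seq mu (@cmeasurable_fourier_exp R) (n 0%N)).
  have [C hC] := gram_seq_bounded (n 0%N) (@cmeasurable_fourier_exp R) (@sqn_fourier_exp R).
  by exists C => x; exact: hC.
have [mp [C hC]] := IHm (marginal mu).
have [C' hC'] := bounded_aux_seq (gam m) (n m.+1).
split.
  apply: cmeasurableM; first exact: (cmeasurable_aux_seq (gam m) (n m.+1)).
  exact: (cmeasurable_comp mp measurable_fst).
by exists (C' * C) => z; rewrite /= sqnM ler_pM ?sqn_ge0.
Qed.

Lemma L2_aux_prod n m (mu : probability (box R m) R) : L2 mu (aux_prod gam n mu).
Proof.
have [mp [C hC]] := aux_prod_bounded n mu.
by apply: (L2_bounded _ mp hC); exact: probability_setT.
Qed.

(** Multi-indices are functions on all of [nat]; this allows [rcons t k] to be replaced by [t] once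
    the last variable is split off. *)
Lemma eq_aux_prod n n' m (mu : probability (box R m) R) :
  (forall i, (i <= m)%N -> n i = n' i) -> aux_prod gam n mu = aux_prod gam n' mu.
Proof.
elim: m mu => [|m IHm] mu nn' /=; first by rewrite nn'.
by rewrite nn'// (IHm (marginal mu))// => i im; apply: nn'; exact: leqW.
Qed.

Lemma fourier_coefE n m (mu : probability (box R m) R) f :
  iterated_slice_measures gam mu -> L2 mu f ->
  fourier_coef gam n mu f = inner mu f (aux_prod gam n mu).
Proof.
elim: m mu f => [//|m IHm] mu f [slices iter] Lf.
have [Lk _] := kaczmarz_opP slices (n m.+1) Lf.
rewrite [LHS](IHm _ _ iter Lk).
exact: (inner_kaczmarz_op slices (n m.+1) Lf (L2_aux_prod n (marginal mu))).
Qed.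

(** The last variable is peeled off by [L2normsq_slice_coef], the induction hypothesis applies to
    each slice coefficient, and the resulting double sum is reindexed by appending the last index to
    the tuple of the others. *)
Lemma aux_prod_parseval m (mu : probability (box R m) R) f :
  mu (cube R m) = 1%E -> iterated_slice_measures gam mu ->
  slice_singular gam mu -> L2 mu f ->
  L2normsq mu f = (\esum_(n in [set: m.+1.-tuple nat])
    (sqn (inner mu f (aux_prod gam (nth 0%N n) mu)))%:E)%E.
Proof.
elim: m mu f => [|m IHm] mu f mu_cube.
  move=> _ sing Lf; have mu1 : mu setT = 1%E by exact: probability_setT.
  rewrite (@reindex_esum _ _ _ setT setT (fun k : nat => [tuple k])).
    exact: (aux_seq_parseval mu1 mu_cube sing Lf).
  split => //.
  - by move=> i j _ _ /(congr1 val) [].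
  - move=> t _; case/tupleP: t => x t; exists x => //.
    by apply: val_inj; rewrite [t]tuple0.
move=> [slices iter] [sing sing'] Lf.
rewrite (L2normsq_slice_coef slices (marginal_cube mu_cube) (@measurable_cube m) sing Lf).
pose a k (t : m.+1.-tuple nat) :=
  (sqn (inner (marginal mu) (slice_coef (gam m) k f) (aux_prod gam (nth 0%N t) (marginal mu))))%:E.
transitivity (\esum_(k in [set: nat]) \esum_(t in [set: m.+1.-tuple nat]) a k t)%E.
  apply: eq_esum => k _; apply: IHm => //; first exact: marginal_cube.
  exact: (L2_slice_coef slices).
rewrite (esum_esum (J := fun=> setT)); last by move=> k t _ _; rewrite lee_fin sqn_ge0.
rewrite [RHS](@reindex_esum _ _ _ ([set: nat] `*`` (fun=> setT)) setT
  (fun p : nat * m.+1.-tuple nat => [tuple of rcons p.2 p.1])).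
  apply: eq_esum => -[k t] _; congr (_%:E); congr sqn.
  have nt : nth 0%N (rcons t k) m.+1 = k by rewrite nth_rcons size_tuple ltnn eqxx.
  have -> : aux_prod gam (nth 0%N [tuple of rcons t k]) mu = fun z =>
      aux_seq (gam m z.1) k z.2 * aux_prod gam (nth 0%N t) (marginal mu) z.1.
    apply/funext => z /=; rewrite nt; congr (_ * _).
    congr (_ z.1); apply: eq_aux_prod => i im.
    by rewrite nth_rcons size_tuple ltnS im.
  rewrite -(inner_kaczmarz_op slices) //; last exact: L2_aux_prod.
  have [[mk _] aek] := kaczmarz_opP slices k Lf.
  apply/esym/ae_eq_inner => //.
    by apply: cmeasurable_slice_coef; exact: L2_measurable Lf.
  by have [] := aux_prod_bounded (nth 0%N t) (marginal mu).
split => //.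
- move=> [k t] [k' t'] _ _ /(congr1 val) /= /rcons_inj [tt' ->].
  by congr (_, _); exact: val_inj.
- move=> t _; case/tupleP: t => x t.
  exists (last x t, [tuple of belast x t]) => //.
  by apply: val_inj; rewrite /= -lastI.
Qed.

End IteratedParseval.

Theorem proposition3p4 (R : realType) (d : nat) (hd : (2 <= d)%N)
    (mu : probability (box R d.-1) R) (mu_cube : mu (cube R d.-1) = 1%E)
    (gam : forall m : nat, R.-pker (box R m) ~> R)
    (gam_slices : iterated_slice_measures gam mu)
    (mu_sing : slice_singular gam mu) :
  (forall f : box R d.-1 -> R[i], L2 mu f ->
     forall n : d.-tuple nat,
       fourier_coef gam (nth 0%N n) mu f =
       inner mu f (aux_prod gam (nth 0%N n) mu)) /\
  parseval_frame mu (fun n : d.-tuple nat => aux_prod gam (nth 0%N n) mu).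
Proof.
split => [f Lf n|]; first exact: fourier_coefE.
split => [n|f Lf]; first exact: L2_aux_prod.
(* With [d] a successor, the tuple length [d.-1.+1] of [aux_prod_parseval] is [d]. *)
case: d hd mu mu_cube gam_slices mu_sing f Lf => // d _ mu mu_cube gs sing f Lf.
rewrite (aux_prod_parseval mu_cube gs sing Lf).
by apply: eq_esum => n _; rewrite normc_sqn.
Qed.
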